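(* Let $N_b<N_h$ be fixed integers, $N_l=N_h-N_b$, and $p\in[0,1]$. Under $\mathbb{P}^{n,N_b,N_h,p}$, as $n\to\infty$ the vector $(\Delta_iH^1/n)_{0\le i<N_l}$ converges in distribution to a random vector $D=(D_0,\dots,D_{N_l-1})$ taking values in $\mathrm{Simplex}(N_l)=\{x=(x_i)_{0\le i<N_l}:\sum_ix_i=1,\ x_i\ge0\}$, where $D_{N_l-1}=1-\sum_{i=0}^{N_l-2}D_i$ and $(D_0,\dots,D_{N_l-2})$ has density with respect to Lebesgue measure on $\mathbb{R}^{N_l-1}$ $$f(x_0,\dots,x_{N_l-2})=x_0\,N_b!\,N_h!\sum_{(b_i):\sum_ib_i=N_b}\ \prod_{k\in\mathbb{Z}/N_l\mathbb{Z}}\frac{x_k^{2b_k}}{b_k!\,(b_k+1)!}\ \mathbf{1}_{\{(x_0,\dots,x_{N_l-1})\in\mathrm{Simplex}(N_l)\}},$$ with $x_{N_l-1}=1-\sum_{i<N_l-1}x_i$ and the sum over tuples $(b_i)_{i\in\mathbb{Z}/N_l\mathbb{Z}}$ of nonnegative integers.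
   Context: Golf process on the cycle $\mathbb{Z}/n\mathbb{Z}$ under $\mathbb{P}^{n,N_b,N_h,p}$: initial configuration uniform among assignments with exactly $N_b$ balls, $N_h$ holes, the rest neutral; clocks i.i.d. uniform on $[0,1]$; at its clock time each ball performs an independent random walk (step $+1$ w.p. $p$, $-1$ w.p. $1-p$) stopped at the first not-yet-filled hole, which it fills. $H^1$ is the set of holes never filled. With $\pi:\mathbb{Z}/n\mathbb{Z}\to\{1,\dots,n\}$ the canonical bijection, a set $X$ of size $k$ is listed as $(x_i)_{i\in\mathbb{Z}/k\mathbb{Z}}$ with $\pi(x_1)<\dots<\pi(x_k)=\pi(x_0)$, and $\Delta_iX=\pi(x_{i+1})-\pi(x_i)-1\bmod n$. *)

(* Defs.v *)
From HB Require Import structures.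
From mathcomp Require Import all_boot all_order all_algebra.
From mathcomp Require Import all_classical all_reals all_analysis.

Set Implicit Arguments.
Unset Strict Implicit.
Unset Printing Implicit Defensive.

Import Order.TTheory GRing.Theory Num.Theory.
Import numFieldNormedType.Exports.

Local Open Scope ring_scope.

(* The cycle Z/nZ is represented by 'I_n, with +1 given by ordS and -1 by    *)
(* ord_pred.  The canonical bijection pi : Z/nZ -> {1,...,n} sends the class *)
(* of j in {1,...,n} to j, i.e. the residue 0 to n.                          *)

Definition piZ (n : nat) (x : 'I_n) : nat := if val x == 0%N then n else val x.

(* A ball at x performs the walk whose successive steps are given by s      *)
(* (true = +1, false = -1); it is stopped at the first site belonging to the *)
(* set O of not-yet-filled holes.  Result: Some h (the hole filled) if this  *)
(* happens within the steps of s, None otherwise.                            *)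
Fixpoint walk_stop (n : nat) (O : {set 'I_n}) (x : 'I_n) (s : seq bool)
  : option 'I_n :=
  match s with
  | [::] => None
  | b :: s' =>
      let y := if b then ordS x else ord_pred x in
      if y \in O then Some y else walk_stop O y s'
  end.

(* The balls act one after another (list bw, in clock order, each with its  *)
(* own walk).  Starting from the set O of unfilled holes, returns the set of *)
(* holes never filled (Some H1), or None if some walk was not stopped within *)
(* its (finite) list of steps.                                               *)
Fixpoint golf_run (n : nat) (O : {set 'I_n}) (bw : seq ('I_n * seq bool))
  : option {set 'I_n} :=
  match bw with
  | [::] => Some O
  | (x, s) :: bw' =>
      match walk_stop O x s with
      | Some h => golf_run (O :\ h) bw'
      | None => None
      end
  end.

Section Golf.
Variable R : realType.

(* initial configurations: (set of balls, set of holes), disjoint, with     *)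
(* exactly Nb balls and Nh holes (the remaining sites are neutral)           *)
Definition valid_config (n Nb Nh : nat) (c : {set 'I_n} * {set 'I_n}) : bool :=
  [&& #|c.1| == Nb, #|c.2| == Nh & [disjoint c.1 & c.2]].

Definition clock_order (n Nb : nat) (B : {set 'I_n}) (t : Nb.-tuple 'I_n) : bool :=
  uniq t && (B == [set x | x \in t]).

Definition steps_weight (p : R) (s : seq bool) : R :=
  \prod_(b <- s) (if b then p else 1 - p).

(* P^{n,Nb,Nh,p}( every ball is stopped within its first T steps and H^1 = S ).
   Uniform initial configuration; the clock order is uniform over the Nb!
   orderings of the balls (i.i.d. uniform clocks, ties have probability 0);
   the walks of the balls are independent, the j-th ball in clock order using
   the steps w j. *)
Definition golf_prob_T (n Nb Nh : nat) (p : R) (T : nat) (S : {set 'I_n}) : R :=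
  \sum_(c : {set 'I_n} * {set 'I_n} | valid_config Nb Nh c)
    (#|[set c' : {set 'I_n} * {set 'I_n} | valid_config Nb Nh c']|%:R)^-1 *
    \sum_(t : Nb.-tuple 'I_n | clock_order c.1 t)
      (#|[set t' : Nb.-tuple 'I_n | clock_order c.1 t']|%:R)^-1 *
      \sum_(w : {ffun 'I_Nb -> T.-tuple bool})
        (\prod_(j < Nb) steps_weight p (w j)) *
        (golf_run c.2 (zip (val t) [seq val (w j) | j <- enum 'I_Nb])
           == Some S)%:R.

(* P^{n,Nb,Nh,p}( H^1 = S ): the increasing limit of the above as T -> oo *)
Definition golf_prob (n Nb Nh : nat) (p : R) (S : {set 'I_n}) : R :=
  limn (fun T => golf_prob_T Nb Nh p T S).

(* Delta_i X for X of size k, listed as x_1 < ... < x_k (for pi), x_0 = x_k: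
   Delta_i X = pi(x_{i+1}) - pi(x_i) - 1 mod n, i in Z/kZ (representative in
   {0,...,n-1}).  Here v is the sorted list of the pi(x_j), x_j = v_{j-1}. *)
Definition gap (n : nat) (X : {set 'I_n}) (i : nat) : nat :=
  let v := sort leq [seq piZ x | x <- enum X] in
  let k := size v in
  let px j := nth 0%N v ((j + k - 1) %% k)%N in
  (((n + px ((i + 1) %% k)%N) - px i - 1) %% n)%N.

Definition gap_vec (n Nl : nat) (X : {set 'I_n}) : 'rV[R]_Nl :=
  \row_(i < Nl) ((gap X i)%:R / n%:R).

Definition golf_expect (n Nb Nh : nat) (p : R) (g : 'rV[R]_(Nh - Nb) -> R) : R :=
  \sum_(S : {set 'I_n}) golf_prob Nb Nh p S * g (gap_vec (Nh - Nb) S).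

Fixpoint iter_integral (k : nat) (F : seq R -> R) : R :=
  match k with
  | 0%N => F [::]
  | k'.+1 =>
      \int[@lebesgue_measure R]_(x in [set: R]) iter_integral k' (fun s => F (x :: s))
  end.

Definition complete_simplex (s : seq R) : seq R := rcons s (1 - \sum_(y <- s) y).

Definition in_simplex (Nl : nat) (xs : seq R) : bool :=
  (size xs == Nl) && ((\sum_(y <- xs) y == 1) && all (fun y => 0 <= y) xs).

Definition golf_density (Nb Nh : nat) (s : seq R) : R :=
  let Nl := (Nh - Nb)%N in
  let xs := complete_simplex s in
  let x (k : 'I_Nl) := nth 0 xs k in
  nth 0 xs 0 * (Nb`!)%:R * (Nh`!)%:R *
  (\sum_(b : {ffun 'I_Nl -> 'I_Nb.+1} | (\sum_(k < Nl) val (b k))%N == Nb)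
     \prod_(k < Nl) (x k ^+ (2 * b k) / ((b k)`! * (b k).+1`!)%:R)) *
  (in_simplex Nl xs)%:R.

Definition limit_expect (Nb Nh : nat) (g : 'rV[R]_(Nh - Nb) -> R) : R :=
  iter_integral (Nh - Nb).-1
    (fun s => g (\row_(i < Nh - Nb) nth 0 (complete_simplex s) i)
              * golf_density Nb Nh s).

End Golf.

Arguments golf_expect {R} n Nb Nh p g.
Arguments limit_expect {R} Nb Nh g.
Arguments golf_density {R} Nb Nh s.

(* Main.v *)
Require Import Defs.
From HB Require Import structures.
From mathcomp Require Import all_boot all_order all_algebra.
From mathcomp Require Import zify ring lra.

(** Up to an error tending to 0 in total variation, the balls may be dropped at
    independent uniform sites, possibly on holes or on other balls.  The set of
    unfilled holes is then a Markov chain.  If S is the set of holes left after a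
    step and h is the hole filled by it, lying in a gap of length d of S, then
    reflecting h inside this gap exchanges the exits to the right with the exits
    to the left: the probabilities of filling h and its mirror image add up to
    d / n, whatever p is.  Hence, by induction on the number j of balls, the mass
    of S is proportional to the coefficient of X^j in the product over the gaps d
    of S of polynomials A_d determined by
      A_d(0) = 1  and  A_d' = (d / 2) * sum_(0 < i < d) A_i * A_(d - i),
    and p has disappeared.  With C_b the Catalan numbers, the coefficient of X^b in
    A_d lies between C_b * 'C(d - 1, 2 b) and C_b * 'C(d + 2 b, 2 b), so it is
    equivalent to d^(2 b) / (b! (b + 1)!).  The expectation is thus a Riemann sum
    over gap vectors; it converges to the iterated integral by dominated
    convergence in each variable.  The factor x_0 of the density counts the
    positions of the origin inside the gap that contains it. *)

Set Implicit Arguments.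
Unset Strict Implicit.
Unset Printing Implicit Defensive.
Import Order.TTheory GRing.Theory Num.Theory.

(** * Gaps of a subset of the cycle *)

Section CycleGaps.
Local Open Scope ring_scope.
Variable n : nat.
Implicit Types (x y z h : 'I_n) (S : {set 'I_n}).

Definition adv x (k : nat) : 'I_n := iter k (@ordS n) x.
Definition bck x (k : nat) : 'I_n := iter k (@ord_pred n) x.

Lemma val_adv x k : val (adv x k) = ((x + k) %% n)%N.
Proof.
elim: k => [|k IHk] /=; first by rewrite addn0 modn_small.
by rewrite -/(adv x k) IHk -addn1 modnDml addn1 addnS.
Qed.

Lemma advD x i j : adv x (i + j) = adv (adv x i) j.
Proof. by rewrite /adv addnC iterD. Qed.

Lemma adv_n x : adv x n = x.
Proof. by apply: val_inj; rewrite val_adv modnDr modn_small. Qed.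

Lemma adv0 x : adv x 0 = x.
Proof. by []. Qed.

Lemma ordS_adv x k : ordS (adv x k) = adv x k.+1.
Proof. by []. Qed.

Lemma ord_pred_adv x k : (0 < k)%N -> ord_pred (adv x k) = adv x k.-1.
Proof. by case: k => // k _; rewrite /= ordSK. Qed.

Lemma adv_inj k : injective (fun x => adv x k).
Proof. by elim: k => //= k IHk x y /(can_inj (@ordSK n)) /IHk. Qed.

Lemma adv_bck x k : adv (bck x k) k = x.
Proof.
elim: k x => //= k IHk x.
by rewrite -[RHS](ord_predK x) -[in RHS](IHk (ord_pred x)) /bck -iterSr.
Qed.

Lemma bck_adv x k : bck (adv x k) k = x.
Proof. by apply: (@adv_inj k); rewrite adv_bck. Qed.

Lemma bck_sub y j k : (j <= k)%N -> adv (bck y k) (k - j) = bck y j.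
Proof.
by move=> jk; apply: (@adv_inj j); rewrite -advD subnK // !adv_bck.
Qed.

Lemma adv_surj x y : exists2 k, (k < n)%N & adv x k = y.
Proof.
exists ((y + (n - x)) %% n)%N; first by rewrite ltn_pmod //; case: x => i; lia.
apply: val_inj; rewrite val_adv modnDmr.
have -> : (x + (y + (n - x)) = y + n)%N by case: x => i /=; lia.
by rewrite modnDr modn_small.
Qed.

(** The search starts one step ahead of [x] and may end at [x] itself after a full turn, so a
    singleton has distance [n]. The distance exceeds by one the number of sites of the gap after
    [x]. *)
Definition next_dist S x : nat := (find (fun k => adv x k.+1 \in S) (iota 0 n)).+1.

Lemma next_distP S x : x \in S ->
  [/\ (0 < next_dist S x <= n)%N, adv x (next_dist S x) \in S &
      forall k, (0 < k < next_dist S x)%N -> adv x k \notin S].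
Proof.
move=> xS.
have n0 : (0 < n)%N by case: x xS => i; lia.
have hs : has (fun k => adv x k.+1 \in S) (iota 0 n).
  by apply/hasP; exists n.-1; rewrite ?mem_iota ?prednK ?adv_n //; lia.
have lt := hs; rewrite has_find size_iota in lt.
split.
- by rewrite /next_dist.
- by have := nth_find 0%N hs; rewrite nth_iota.
- move=> [|k] // /andP[_]; rewrite /next_dist ltnS => kl.
  have := before_find 0%N kl; rewrite nth_iota ?add0n; last exact: ltn_trans lt.
  by move=> ->.
Qed.

Lemma next_dist_eq S x d : (0 < d <= n)%N -> adv x d \in S ->
  (forall k, (0 < k < d)%N -> adv x k \notin S) -> next_dist S x = d.
Proof.
case: d => // d /andP[_ dn] dS nS; rewrite /next_dist; congr _.+1.
case: findP => [/hasPn /(_ d)|i].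
  by rewrite mem_iota /= add0n dn dS => /(_ isT).
rewrite size_iota => iln hi hni.
have := hi 0%N; rewrite nth_iota // add0n => iS.
case: (ltngtP i d) => // id.
  by have := nS i.+1; rewrite iS => /(_ ltac:(lia)).
by have := hni 0%N d id; rewrite nth_iota ?add0n ?dS.
Qed.

(** Every site is reached in exactly one way from the nearest point of [S] at or behind it, in fewer
    steps than the next point of [S]. *)
Lemma sum_gaps (V : nmodType) (S : {set 'I_n}) (F : 'I_n -> V) : S != set0 ->
  \sum_y F y = \sum_(x in S) \sum_(0 <= k < next_dist S x) F (adv x k).
Proof.
move=> /set0Pn[z zS].
transitivity (\sum_(x in S) \sum_(k < n | (k < next_dist S x)%N) F (adv x k));
  last first.
  apply: eq_bigr => x /next_distP[/andP[_ len] _ _].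
  rewrite (big_nat_widen _ _ _ _ _ len) big_mkord.
  by apply: eq_bigl.
rewrite (exchange_big_dep xpredT) //=.
transitivity (\sum_(k < n) \sum_(y | (bck y k \in S) &&
    (k < next_dist S (bck y k))%N) F y); last first.
  apply: eq_bigr => k _; rewrite [RHS](reindex_onto (bck ^~ k) (adv ^~ k)); last first.
    by move=> x _; rewrite bck_adv.
  by apply: eq_big => [y|y _]; rewrite adv_bck // eqxx andbT.
rewrite (exchange_big_dep xpredT) //=; apply: eq_bigr => y _.
(* The least such [k] leads back to the nearest point of [S]; from any other point of [S] the way to
   [y] passes through [S] again. *)
have ex : exists k, (k < n)%N && (bck y k \in S).
  have [k kn ky] := adv_surj z y; exists k; rewrite kn.
  by rewrite -ky bck_adv.
case: (ex_minnP ex) => k /andP[kn kS] kmin.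
rewrite (big_pred1 (Ordinal kn)) // => j /=; rewrite -val_eqE /=.
apply/andP/eqP => [[jS jlt]|jk].
  have kj := kmin j; rewrite ltn_ord jS in kj; have {}kj := kj isT.
  apply/eqP; rewrite eqn_leq kj andbT leqNgt; apply/negP => kltj.
  have [_ _ /(_ (j - k)%N)] := next_distP jS.
  by rewrite bck_sub // kS => /(_ ltac:(lia)).
rewrite jk; split=> //; rewrite ltnNge; apply/negP => dk.
have [/andP[d0 dn] dS _] := next_distP kS.
have := kmin (k - next_dist S (bck y k))%N.
rewrite -(bck_sub y (leq_subr _ k)) subKn // dS andbT; lia.
Qed.

Lemma sum_notin (V : nmodType) S (F : 'I_n -> V) : S != set0 ->
  \sum_(y | y \notin S) F y =
  \sum_(x in S) \sum_(1 <= k < next_dist S x) F (adv x k).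
Proof.
move=> S0; rewrite big_mkcond (sum_gaps _ S0); apply: eq_bigr => x xS.
have [/andP[d0 _] _ nS] := next_distP xS.
rewrite big_ltn //= xS add0r; apply: eq_big_nat => k kd.
by rewrite nS.
Qed.

(** If the offsets differed, the point with the smaller offset would lie strictly inside the gap of
    the other one. *)
Lemma adv_gap_inj S x y i k : x \in S -> y \in S ->
  (i < next_dist S x)%N -> (k < next_dist S y)%N -> adv x i = adv y k -> x = y /\ i = k.
Proof.
wlog ik : x y i k / (i <= k)%N.
  move=> H xS yS il kl e; case/orP: (leq_total i k) => [ik|ki]; first exact: H.
  by have [-> ->] := H y x k i ki yS xS kl il (esym e).
move=> xS yS il kl e.
have : x = adv y (k - i) by apply: (@adv_inj i); rewrite e -advD subnK.
case: (posnP (k - i)) => [ki|ki xE].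
  by rewrite ki => ->; split=> //; lia.
have [_ _ /(_ (k - i)%N)] := next_distP yS.
by rewrite -xE xS => /(_ ltac:(lia)).
Qed.

Section Insert.
Variables (S : {set 'I_n}) (x : 'I_n) (i : nat).
Hypotheses (xS : x \in S) (i_gap : (0 < i < next_dist S x)%N).
Let h := adv x i.
Let O := h |: S.

Lemma insert_notin : h \notin S.
Proof. by have [_ _ H] := next_distP xS; apply: H. Qed.

(** A new point [h] cuts one gap of length [d] into lengths [i] and [d - i] and leaves the others
    alone; this is the source of the product over gaps. *)
Lemma next_dist_insert_left : next_dist O x = i.
Proof.
have [/andP[_ dn] _ H] := next_distP xS.
apply: next_dist_eq; [lia|by rewrite setU11|] => k kl.
rewrite in_setU1 negb_or H ?andbT; last lia.
by apply/eqP => /(adv_gap_inj xS xS) []; lia.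
Qed.

Lemma next_dist_insert_new : next_dist O h = (next_dist S x - i)%N.
Proof.
have [/andP[_ dn] dS H] := next_distP xS.
apply: next_dist_eq; first lia.
  by rewrite -advD subnKC ?in_setU1 ?dS ?orbT //; lia.
move=> k kl; rewrite -advD in_setU1 negb_or H ?andbT; last lia.
by apply/eqP => /(adv_gap_inj xS xS) []; lia.
Qed.

Lemma next_dist_insert_other y : y \in S -> y != x -> next_dist O y = next_dist S y.
Proof.
move=> yS yx; have [/andP[d0 dn] dS H] := next_distP yS.
apply: next_dist_eq; rewrite ?d0 // ?in_setU1 ?dS ?orbT // => k kl.
rewrite in_setU1 negb_or H // andbT; apply/eqP => /(adv_gap_inj yS xS).
by case; [lia|lia|move=> yE; rewrite yE eqxx in yx].
Qed.

End Insert.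
End CycleGaps.
Arguments adv : simpl never.
Arguments next_dist : simpl never.

(** * Subsets of the cycle and gap vectors *)

Section PositionLists.
Variable n : nat.
Implicit Types (x y : 'I_n) (S : {set 'I_n}) (v c : seq nat).

Lemma piZ_bounds x : 0 < piZ x <= n.
Proof. by rewrite /piZ; case: eqP => x0; case: x x0 => i /=; lia. Qed.

Lemma piZ_mod x : piZ x %% n = x.
Proof.
rewrite /piZ; case: eqP => x0; first by rewrite modnn -x0.
exact: modn_small (ltn_ord x).
Qed.

Lemma piZ_inj : injective (@piZ n).
Proof. by move=> x y xy; apply: val_inj; rewrite /= -piZ_mod xy piZ_mod. Qed.

Lemma piZ_surj u : 0 < u <= n -> exists x, @piZ n x = u.
Proof.
move=> un; have un' : u %% n < n by rewrite ltn_mod; lia.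
exists (Ordinal un'); rewrite /piZ /=; case: (ltngtP u n) => [lt|gt|->].
- by rewrite modn_small // ifF //; apply/eqP; lia.
- by lia.
- by rewrite modnn eqxx.
Qed.

(** Residue 0 sits at position [n], so a position wraps around only when the sum exceeds [n], not
    when it equals [n]. *)
Lemma piZ_adv x k : k <= n ->
  piZ (adv x k) = if piZ x + k <= n then piZ x + k else piZ x + k - n.
Proof.
move=> kn; have := piZ_bounds x; rewrite [piZ (adv x k)]/piZ val_adv.
rewrite -[X in (X + k) %% n](piZ_mod x) modnDml.
move: (piZ x) => u ub; case: (ltngtP (u + k) n) => [lt|gt|->].
- by rewrite modn_small // ifF //; apply/eqP; lia.
- have -> : (u + k) %% n = (u + k - n) %% n by rewrite -[in LHS](subnK (ltnW gt)) modnDr.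
  case: (ltngtP (u + k - n) n) => [lt|gt2|->].
  + by rewrite modn_small // ifF //; apply/eqP; lia.
  + by lia.
  + by rewrite modnn eqxx.
- by rewrite modnn eqxx.
Qed.


Definition positions S : seq nat := sort leq [seq piZ x | x <- enum S].

(** These are exactly the lists of the form [positions S], which makes subsets and such lists
    interchangeable. *)
Definition good_list v : bool := sorted ltn v && all (fun u => 0 < u <= n) v.

Lemma mem_positions S x : (piZ x \in positions S) = (x \in S).
Proof. by rewrite mem_sort mem_map ?mem_enum //; exact: piZ_inj. Qed.

Lemma size_positions S : size (positions S) = #|S|.
Proof. by rewrite size_sort size_map -cardE. Qed.

Lemma good_positions S : good_list (positions S).
Proof.
apply/andP; split.
  rewrite ltn_sorted_uniq_leq sort_uniq map_inj_uniq ?enum_uniq /=; last exact: piZ_inj.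
  exact: (sort_sorted leq_total).
by apply/allP => u; rewrite mem_sort => /mapP[x _ ->]; exact: piZ_bounds.
Qed.

Definition set_at v : {set 'I_n} := [set x | piZ x \in v].

Lemma positionsK S : set_at (positions S) = S.
Proof. by apply/setP => x; rewrite inE mem_positions. Qed.

Lemma set_atK v : good_list v -> positions (set_at v) = v.
Proof.
case/andP=> sv av; have sp : sorted ltn (positions (set_at v)).
  by case/andP: (good_positions (set_at v)).
apply: (irr_sorted_eq ltn_trans ltnn sp sv) => u.
apply/idP/idP => [|uv].
  by rewrite mem_sort => /mapP[x]; rewrite mem_enum inE => xv ->.
have [x xu] := piZ_surj (allP av _ uv).
by rewrite -xu mem_positions inE xu.
Qed.

(* The first entry is the gap through the origin, as in Delta_0. *)
Definition list_gaps v : seq nat :=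
  if v is v0 :: v' then
    (n + v0 - last v0 v' - 1) :: pairmap (fun u w => w - u - 1) v0 v'
  else [::].

(* r is the number of sites of the first gap before the first point; the size of
   that gap itself is not needed. *)
Definition list_of_gaps (r : nat) c : seq nat :=
  r.+1 :: scanl (fun u d => u + d.+1) r.+1 (behead c).

Lemma last_scanl r c : last r (scanl (fun u d => u + d.+1) r c) = r + sumn c + size c.
Proof. elim: c r => [|d c IHc] r /=; [lia|rewrite IHc; lia]. Qed.

Lemma path_scanl r c : path ltn r (scanl (fun u d => u + d.+1) r c).
Proof. elim: c r => //= d c IHc r; rewrite IHc andbT; lia. Qed.

(** The offset [r] cancels in all differences; the gap through the origin is recovered because gaps
    and points together fill the cycle. *)
Lemma list_of_gapsK r c : 0 < size c -> sumn c + size c = n ->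
  list_gaps (list_of_gaps r c) = c.
Proof.
case: c => // d c _ /= cn; rewrite /list_gaps /list_of_gaps last_scanl; congr (_ :: _).
  rewrite /=; lia.
by rewrite scanlK // => u w; lia.
Qed.

Lemma last_pairmap (v0 : nat) v : path ltn v0 v ->
  last v0 v = v0 + sumn (pairmap (fun u w => w - u - 1) v0 v) + size v.
Proof.
elim: v v0 => [|w v IHv] v0 /=; first by lia.
by move=> /andP[lt /IHv ->]; lia.
Qed.

Lemma list_gapsK v : good_list v -> 0 < size v ->
  list_of_gaps (head 0 v).-1 (list_gaps v) = v.
Proof.
case: v => // v0 v /= /andP[/= pv /andP[/andP[v00 _] _]] _.
rewrite /list_of_gaps /= prednK //; congr (_ :: _).
elim: v v0 pv {v00} => //= w v IHv v0 /andP[lt pv].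
have -> : v0 + (w - v0 - 1).+1 = w by lia.
by rewrite IHv.
Qed.

Lemma last_bounds (v0 : nat) v : good_list (v0 :: v) -> v0 <= last v0 v <= n.
Proof.
case/andP => /= pv /andP[/andP[_ v0n] av]; apply/andP; split.
  by rewrite (last_pairmap pv); lia.
have := mem_last v0 v; rewrite inE => /orP[/eqP ->//|/(allP av) /andP[] //].
Qed.

Lemma sumn_list_gaps v : good_list v -> 0 < size v ->
  sumn (list_gaps v) + size v = n.
Proof.
case: v => // v0 v gv _; have := last_bounds gv.
have/andP[/= pv /andP[/andP[v00 v0n] _]] := gv.
have := last_pairmap pv; lia.
Qed.

Lemma size_list_gaps v : size (list_gaps v) = size v.
Proof. by case: v => //= v0 v; rewrite size_pairmap. Qed.

Lemma path_le_last (r : nat) s u : path ltn r s -> u \in s -> u <= last r s.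
Proof.
elim: s r => //= w s IHs r /andP[_ ps]; rewrite inE => /orP[/eqP ->|]; last exact: IHs.
by rewrite (last_pairmap ps); lia.
Qed.

Lemma good_list_of_gaps r c : 0 < size c -> sumn c + size c = n -> r <= head 0 c ->
  good_list (list_of_gaps r c).
Proof.
case: c => // d c _ /= cn rd; rewrite /good_list /list_of_gaps /=.
rewrite path_scanl /=; apply/andP; split; first by lia.
apply/allP => u us.
have ps := path_scanl r.+1 c.
have /= ru := allP (order_path_min ltn_trans ps) _ us.
rewrite (leq_ltn_trans _ ru) //=.
have := path_le_last ps us; rewrite last_scanl; lia.
Qed.

Lemma gap_nth S i : i < #|S| -> gap S i = nth 0 (list_gaps (positions S)) i.
Proof.
move=> iS; rewrite /gap -/(positions S).
have gS := good_positions S; rewrite -size_positions in iS.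
move: (positions S) gS iS => v gv iv.
(* Points are numbered from 1 and list entries from 0, so point [i + 1] is entry [i]. *)
have -> : ((i + 1) %% size v + size v - 1) %% size v = i.
  rewrite -addnBA ?(leq_ltn_trans _ iv) // modnDml.
  by rewrite (_ : i + 1 + _ = i + size v); [rewrite modnDr modn_small|lia].
case: v gv iv => // v0 v gv; have lb := last_bounds gv.
have/andP[/= pv /andP[/andP[v00 v0n] av]] := gv.
case: i => [|i] iv.
  (* For [i = 0] the preceding point is the last entry, one turn earlier. *)
  have -> : (0 + size (v0 :: v) - 1) %% size (v0 :: v) = (size (v0 :: v)).-1.
    by rewrite modn_small /=; lia.
  by rewrite nth_last /= modn_small //; lia.
have -> : (i.+1 + size (v0 :: v) - 1) %% size (v0 :: v) = i.
  rewrite (_ : i.+1 + _ - 1 = i + size (v0 :: v)); last lia.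
  by rewrite modnDr modn_small //; exact: ltnW iv.
rewrite /= ltnS in iv; rewrite [RHS]/= [nth 0 (v0 :: v) i.+1]/=.
rewrite (nth_pairmap 0) //.
have a1 : nth 0 (v0 :: v) i < nth 0 v i.
  have := sorted_ltn_nth ltn_trans 0 (s := v0 :: v) pv i i.+1.
  by rewrite !inE /=; apply => //; lia.
have a2 : nth 0 v i <= n by have := allP av (nth 0 v i) (mem_nth 0 iv); lia.
have a3 : 0 < nth 0 (v0 :: v) i.
  by case: i iv {a1 a2} => //= i iv; have := allP av (nth 0 v i) (mem_nth 0 (ltnW iv)); lia.
rewrite (_ : _ - 1 = nth 0 v i - nth 0 (v0 :: v) i - 1 + n); last lia.
rewrite modnDr modn_small //; lia.
Qed.

(** The gap after entry [i] of the positions is entry [i + 1] of the list of gaps, and the gap after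
    the last one is entry 0; a product does not see this rotation. *)
Lemma prod_next_dist (R : comNzRingType) (S : {set 'I_n}) (f : nat -> R) :
  (\prod_(x in S) f (next_dist S x) = \prod_(c <- list_gaps (positions S)) f c.+1)%R.
Proof.
have gS := good_positions S; have mS := mem_positions S.
have [x0 _|noI] := pickP 'I_n; last first.
  have -> : positions S = [::].
    case/andP: gS => _; case: (positions S) => // u v /= /andP[/piZ_surj[x _] _].
    by have := noI x.
  by rewrite big_nil big1 // => x; have := noI x.
pose inv u := odflt x0 [pick x | @piZ n x == u].
have invK x : inv (piZ x) = x.
  rewrite /inv; case: pickP => [y /eqP /piZ_inj ->//|/(_ x)].
  by rewrite eqxx.
transitivity (\prod_(u <- positions S) f (next_dist S (inv u)))%R.
  rewrite -big_enum /= (perm_big _ (permEl (perm_sort _ _))) big_map.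
  by apply: eq_bigr => x _; rewrite invK.
have szE := size_positions S.
move: (positions S) gS mS => v gv mS {szE}.
case: v gv mS => [|v0 v] gv mS; first by rewrite !big_nil.
have lb := last_bounds gv.
have/andP[/= pv _] := gv.
have av : all (fun u => 0 < u <= n) (v0 :: v) by case/andP: gv.
have sn i j : i < j -> j <= size v -> nth 0 (v0 :: v) i < nth 0 (v0 :: v) j.
  move=> ij jv; have := sorted_ltn_nth ltn_trans 0 (s := v0 :: v) pv i j.
  by rewrite !inE /=; apply => //; lia.
have bd i : i <= size v -> 0 < nth 0 (v0 :: v) i <= n.
  by move=> iv; apply: (allP av); apply: mem_nth.
(* After the last entry the next point is the first one, reached by crossing the origin. *)
have nd i : i <= size v -> next_dist S (inv (nth 0 (v0 :: v) i)) =
    if i < size v then nth 0 v i - nth 0 (v0 :: v) i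
    else n + v0 - nth 0 (v0 :: v) i.
  move=> iv; have [x xE] := piZ_surj (bd i iv); rewrite -xE invK.
  have lastE : nth 0 (v0 :: v) (size v) = last v0 v by rewrite nth_last.
  case: ltnP => iv2.
    have a1 := sn i i.+1 (ltnSn i) iv2; have /= a2 := bd i.+1 iv2; rewrite -xE /= in a1.
    apply: next_dist_eq; first by lia.
      rewrite -mS piZ_adv; last by lia.
      rewrite ifT; last by lia.
      rewrite subnKC; last by lia.
      by rewrite inE mem_nth ?orbT.
    move=> k kl; rewrite -mS piZ_adv; last by lia.
    rewrite ifT; last by lia.
    apply/negP => /(nthP 0)[j jv E]; rewrite /= ltnS in jv.
    have [ji|ij] := leqP j i.
      have : nth 0 (v0 :: v) j <= nth 0 (v0 :: v) i.
        by move: ji; rewrite leq_eqVlt => /orP[/eqP ->//|ji]; apply: ltnW; apply: sn.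
      by rewrite E -xE; lia.
    have : nth 0 (v0 :: v) i.+1 <= nth 0 (v0 :: v) j.
      by move: ij; rewrite leq_eqVlt => /orP[/eqP ->//|ij]; apply: ltnW; apply: sn.
    by rewrite E /=; lia.
  have iE : i = size v by lia.
  rewrite iE lastE in xE; rewrite xE.
  apply: next_dist_eq; first by have := bd 0 isT; rewrite /=; lia.
    rewrite -mS piZ_adv; last by lia.
    rewrite xE.
    have := bd 0 isT; rewrite /= => b0.
    rewrite ifF; last by lia.
    rewrite (_ : _ - n = v0); last by lia.
    by rewrite inE eqxx.
  move=> k kl; rewrite -mS piZ_adv; last by lia.
  rewrite xE.
  apply/negP => /(nthP 0)[j jv E]; rewrite /= ltnS in jv.
  have j1 : nth 0 (v0 :: v) j <= last v0 v.
    rewrite -lastE; move: jv; rewrite leq_eqVlt => /orP[/eqP ->//|ji].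
    by apply: ltnW; apply: sn.
  have j2 : v0 <= nth 0 (v0 :: v) j.
    by case: j jv {E j1} => // j jv; apply: ltnW; have := sn 0 j.+1 isT jv.
  by move: E; case: (leqP (last v0 v + k) n) => H E; rewrite E in j1 j2; lia.
transitivity (\prod_(c <- (rcons (pairmap (fun u w => w - u - 1) v0 v)
     (n + v0 - last v0 v - 1))%N) f c.+1)%R; last first.
  by rewrite big_rcons /= big_cons mulrC.
rewrite -(big_map (fun u => next_dist S (inv u)) xpredT f).
rewrite -(big_map succn xpredT f); congr (bigop.body _ _ _).
apply: (@eq_from_nth _ 0); first by rewrite !size_map size_rcons size_pairmap.
move=> i; rewrite size_map [size _]/= ltnS => iv.
rewrite !(nth_map 0) ?size_rcons ?size_pairmap //.
rewrite nd // nth_rcons size_pairmap.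
case: ltnP => iv2.
  rewrite (nth_pairmap 0) //; have := sn i i.+1 (ltnSn i) iv2; rewrite /=; lia.
have -> : i = size v by lia.
by rewrite eqxx nth_last /=; have := bd 0 isT; rewrite /=; lia.
Qed.

End PositionLists.

(* k free gaps a determine the last one, since the k + 1 gaps sum to N. *)
Definition close_gaps (N : nat) (a : seq nat) : seq nat := rcons a (N - sumn a).

Lemma size_close_gaps N a : size (close_gaps N a) = (size a).+1.
Proof. exact: size_rcons. Qed.

Lemma sumn_close_gaps N a : sumn a <= N -> sumn (close_gaps N a) = N.
Proof. by move=> aN; rewrite /close_gaps sumn_rcons subnKC. Qed.

Lemma close_gaps_take N k c : size c = k.+1 -> sumn c = N -> close_gaps N (take k c) = c.
Proof.
case/lastP: c => // a d; rewrite size_rcons sumn_rcons => -[<-] <-.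
by rewrite -cats1 take_size_cat // /close_gaps cats1 addKn.
Qed.

Lemma head_le_sumn c : head 0 c <= sumn c.
Proof. by case: c => //= d c; rewrite leq_addr. Qed.

Lemma nth_le_sumn c i : nth 0 c i <= sumn c.
Proof. by elim: c i => [|d c IHc] [|i] //=; [lia|have := IHc i; lia]. Qed.

Lemma size_list_of_gaps r c : 0 < size c -> size (list_of_gaps r c) = size c.
Proof. by case: c => // d c _; rewrite /= size_scanl. Qed.

(** * Sums over subsets as sums over gap vectors *)

Section SumSets.
Variables (n N k : nat).
Hypothesis nE : n = N + k.+1.

(** A set is coded by its first [k] gaps and by the number of sites before its first point; for sets
    of size [k + 1] all are at most [N], so [inord] loses nothing. *)
Definition set_code (S : {set 'I_n}) : k.-tuple 'I_N.+1 * 'I_N.+1 :=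
  ([tuple inord (nth 0 (list_gaps n (positions S)) i) | i < k],
   inord (head 0 (positions S)).-1).

Definition set_decode (q : k.-tuple 'I_N.+1 * 'I_N.+1) : {set 'I_n} :=
  set_at n (list_of_gaps q.2 (close_gaps N (map val q.1))).

(** The sites before the first point belong to the gap through the origin, hence the bound on
    [q.2]. *)
Definition valid_code (q : k.-tuple 'I_N.+1 * 'I_N.+1) : bool :=
  (sumn (map val q.1) <= N) && (q.2 <= head 0 (close_gaps N (map val q.1))).

Lemma positions_decode q : valid_code q ->
  positions (set_decode q) = list_of_gaps q.2 (close_gaps N (map val q.1)) /\
  list_gaps n (positions (set_decode q)) = close_gaps N (map val q.1).
Proof.
case/andP=> aN rc; set c := close_gaps _ _ in rc *.
have c0 : 0 < size c by rewrite size_close_gaps.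
have cn : sumn c + size c = n.
  by rewrite sumn_close_gaps // size_close_gaps size_map size_tuple.
have g := good_list_of_gaps c0 cn rc.
by rewrite /set_decode -/c (set_atK g) list_of_gapsK.
Qed.

Lemma set_decodeK q : valid_code q -> set_code (set_decode q) = q.
Proof.
move=> vq; have [p1 p2] := positions_decode vq.
case: q vq p1 p2 => a r vq p1 p2; rewrite /set_code p2 p1 /=; congr (_, _).
  apply: eq_from_tnth => i; apply: val_inj.
  rewrite tnth_mktuple /close_gaps nth_rcons size_map size_tuple ltn_ord.
  have -> : nth 0 (map val a) i = tnth a i :> nat.
    by rewrite (nth_map ord0) ?size_tuple // (tnth_nth ord0).
  by rewrite /= inordK.
by apply: val_inj; rewrite /= inordK.
Qed.

Lemma set_codeK (S : {set 'I_n}) : #|S| = k.+1 ->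
  [/\ valid_code (set_code S), set_decode (set_code S) = S &
      close_gaps N (map val (set_code S).1) = list_gaps n (positions S)].
Proof.
move=> Sk; have gS := good_positions S.
have szS : size (positions S) = k.+1 by rewrite size_positions.
set c := list_gaps n (positions S).
have szc : size c = k.+1 by rewrite size_list_gaps.
have sc : sumn c = N by have := sumn_list_gaps gS; rewrite szS -/c; lia.
have aE : map val (set_code S).1 = take k c.
  apply: (@eq_from_nth _ 0); first by rewrite size_map size_tuple size_take szc ltnSn.
  move=> i; rewrite size_map size_tuple => ik.
  rewrite (nth_map ord0) ?size_tuple // nth_take //.
  have -> : nth ord0 (set_code S).1 i = tnth (set_code S).1 (Ordinal ik).
    by rewrite (tnth_nth ord0).
  by rewrite tnth_mktuple [val _]/= inordK // ltnS -sc nth_le_sumn.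
have cE : close_gaps N (map val (set_code S).1) = c by rewrite aE close_gaps_take.
have hc : (head 0 (positions S)).-1 <= head 0 c.
  rewrite /c; move: gS szS; case: (positions S) => // v0 v gv _ /=.
  by have := last_bounds gv; lia.
have rE : (set_code S).2 = (head 0 (positions S)).-1 :> nat.
  by rewrite /= inordK // ltnS (leq_trans hc) // -sc head_le_sumn.
split=> //.
  by rewrite /valid_code cE rE hc andbT aE -sc -{2}(cat_take_drop k c) sumn_cat leq_addr.
by rewrite /set_decode cE rE list_gapsK ?szS // positionsK.
Qed.

(** A gap vector with first gap [c] comes from [c + 1] sets, since 0 to [c] sites of that gap may
    precede the first point. This multiplicity becomes the factor [x_0]. *)
Lemma sum_sets_gaps (V : nmodType) (F : seq nat -> V) :
  (\sum_(S : {set 'I_n} | #|S| == k.+1) F (list_gaps n (positions S)) =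
   \sum_(a : k.-tuple 'I_N.+1 | (sumn (map val a) <= N)%N)
     F (close_gaps N (map val a)) *+ (head 0 (close_gaps N (map val a))).+1)%R.
Proof.
transitivity (\sum_(q : k.-tuple 'I_N.+1 * 'I_N.+1 | valid_code q)
    F (close_gaps N (map val q.1)))%R; last first.
  rewrite -(pair_big_dep (fun a : k.-tuple 'I_N.+1 => sumn (map val a) <= N)
    (fun a (r : 'I_N.+1) => r <= head 0 (close_gaps N (map val a)))
    (fun a _ => F (close_gaps N (map val a)))) /=.
  apply: eq_bigr => a aN.
  have hN : (head 0 (close_gaps N (map val a))).+1 <= N.+1.
    by rewrite ltnS -[X in _ <= X](sumn_close_gaps aN) head_le_sumn.
  by rewrite (big_ord_narrow hN) sumr_const card_ord.
rewrite [RHS](reindex_onto set_code set_decode); last exact: set_decodeK.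
apply: eq_big => [S|S /eqP Sk]; last by have [_ _ ->] := set_codeK Sk.
apply/idP/idP => [/eqP Sk|/andP[vS /eqP SE]].
  by have [v1 -> _] := set_codeK Sk; rewrite v1 eqxx.
have [p1 _] := positions_decode vS.
by rewrite -size_positions -SE p1 size_list_of_gaps size_close_gaps // size_map size_tuple.
Qed.

End SumSets.

From mathcomp Require Import all_classical all_reals all_analysis.
From mathcomp Require Import measurable_realfun.
Import numFieldNormedType.Exports.
Local Open Scope classical_set_scope.
Local Open Scope ring_scope.

(** * Walks stopped at a set of holes *)

Lemma cvg_bigsum (R : realType) (I : Type) (r : seq I) (P : pred I)
    (u : I -> nat -> R) (l : I -> R) :
  (forall i, P i -> u i @ \oo --> l i) ->
  (fun n => \sum_(i <- r | P i) u i n) @ \oo --> \sum_(i <- r | P i) l i.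
Proof. by apply: cvg_big; exact: add_continuous. Qed.

Lemma cvg_bigprod (R : realType) (I : Type) (r : seq I) (P : pred I)
    (u : I -> nat -> R) (l : I -> R) :
  (forall i, P i -> u i @ \oo --> l i) ->
  (fun n => \prod_(i <- r | P i) u i n) @ \oo --> \prod_(i <- r | P i) l i.
Proof. by apply: cvg_big; exact: mul_continuous. Qed.

Lemma cvg_limE (R : realType) (u : nat -> R) (l : R) : u @ \oo --> l -> limn u = l.
Proof. by move=> ul; apply/cvg_lim. Qed.

Lemma sum_tuple_cons (V : nmodType) (X : finType) (T : nat) (F : seq X -> V) :
  \sum_(t : T.+1.-tuple X) F t = \sum_(a : X) \sum_(t : T.-tuple X) F (a :: t).
Proof.
rewrite pair_big /=.
rewrite (reindex (fun q : X * T.-tuple X => [tuple of q.1 :: q.2])) //=.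
exists (fun t => (thead t, [tuple of behead t])) => [[a t] _|t _] /=.
  by congr (_, _); apply: val_inj.
by rewrite -tuple_eta.
Qed.
Arguments sum_tuple_cons {V X T} F.

Section Walk.
Variables (R : realType) (p : R).
Hypothesis p01 : 0 <= p <= 1.

Let p0 : 0 <= p. Proof. by case/andP: p01. Qed.
Let q0 : 0 <= 1 - p. Proof. by rewrite subr_ge0; case/andP: p01. Qed.

Lemma sum_steps_weight T : \sum_(s : T.-tuple bool) steps_weight p s = 1.
Proof.
elim: T => [|T IHT].
  rewrite (big_pred1 [tuple]) /=; last by move=> t; apply/esym/eqP; exact: tuple0.
  by rewrite /steps_weight big_nil.
rewrite (sum_tuple_cons (fun s => steps_weight p s)) big_bool.
have H (b : bool) : \sum_(t : T.-tuple bool) steps_weight p (b :: t) = if b then p else 1 - p.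
  under eq_bigr do rewrite /steps_weight big_cons -/(steps_weight _ _).
  by rewrite -mulr_sumr IHT mulr1.
by rewrite !H /= addrC subrK.
Qed.

Section Cycle.
Variable n : nat.
Implicit Types (x y z h : 'I_n) (O S : {set 'I_n}).

Definition hit_within T O x h : R :=
  \sum_(s : T.-tuple bool) steps_weight p s * (walk_stop O x s == Some h)%:R.

(** Here a walk started in [O] stops at once, whereas [hit_within] always makes a first step; this
    variant solves the boundary value problem on a gap. *)
Definition hit0_within T O y h : R :=
  if y \in O then (y == h)%:R else hit_within T O y h.

Lemma hit_within0 O x h : hit_within 0 O x h = 0.
Proof. by rewrite /hit_within big1 // => t _; rewrite [t]tuple0 /= mulr0. Qed.

(** First-step decomposition; when the first step already hits [O], the weights of the remaining
    steps sum to 1. *)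
Lemma hit_withinS T O x h :
  hit_within T.+1 O x h =
  p * hit0_within T O (ordS x) h + (1 - p) * hit0_within T O (ord_pred x) h.
Proof.
rewrite /hit_within
  (sum_tuple_cons (fun s => steps_weight p s * (walk_stop O x s == Some h)%:R)).
rewrite big_bool /=.
have H (b : bool) (y : 'I_n) : \sum_(t : T.-tuple bool) steps_weight p (b :: t) *
    ((if y \in O then Some y else walk_stop O y t) == Some h)%:R =
    (if b then p else 1 - p) * hit0_within T O y h.
  rewrite /hit0_within; under eq_bigr do rewrite /steps_weight big_cons /= -mulrA.
  rewrite -mulr_sumr; congr (_ * _); case: ifP => // _.
  under eq_bigr do rewrite (inj_eq Some_inj).
  by rewrite -mulr_suml sum_steps_weight mul1r.
by rewrite (H true) (H false).
Qed.

Lemma hit_within_ge0 T O x h : 0 <= hit_within T O x h.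
Proof.
apply: sumr_ge0 => s _; apply: mulr_ge0 => //.
by apply: prodr_ge0 => -[].
Qed.

Lemma hit_within_homo T O x h : hit_within T O x h <= hit_within T.+1 O x h.
Proof.
elim: T x => [|T IHT] x; first by rewrite hit_within0 hit_within_ge0.
rewrite !hit_withinS lerD // ler_wpM2l // /hit0_within; by case: ifP.
Qed.

Lemma sum_hit_within_le1 T O x : \sum_h hit_within T O x h <= 1.
Proof.
elim: T x => [|T IHT] x; first by rewrite big1 // => h _; rewrite hit_within0.
under eq_bigr => ? _ do rewrite hit_withinS.
rewrite big_split /= -!mulr_sumr.
have H y : \sum_h hit0_within T O y h <= 1.
  rewrite /hit0_within; case: (y \in O) => //.
  by rewrite (bigD1 y) //= eqxx big1 ?addr0 // => h /negbTE hy; rewrite eq_sym hy.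
have := H (ordS x); have := H (ord_pred x); have := p0; have := q0; nra.
Qed.

Lemma hit_within_le1 T O x h : hit_within T O x h <= 1.
Proof.
apply: le_trans (sum_hit_within_le1 T O x); rewrite (bigD1 h) //= lerDl.
by apply: sumr_ge0 => ? _; exact: hit_within_ge0.
Qed.

Definition hit O x h : R := limn (fun T => hit_within T O x h).

Lemma cvg_hit O x h : (fun T => hit_within T O x h) @ \oo --> hit O x h.
Proof.
apply: nondecreasing_is_cvgn; first by apply/nondecreasing_seqP => T; exact: hit_within_homo.
by exists 1 => _ [T _ <-]; exact: hit_within_le1.
Qed.

Lemma hit_ge0 O x h : 0 <= hit O x h.
Proof.
apply: limr_ge; first by apply/cvgP; exact: cvg_hit.
by apply: nearW => T; exact: hit_within_ge0.
Qed.

Lemma sum_hit_le1 O x : \sum_h hit O x h <= 1.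
Proof.
have H : (fun T => \sum_h hit_within T O x h) @ \oo --> \sum_h hit O x h.
  by apply: cvg_bigsum => h _; exact: cvg_hit.
rewrite -(cvg_limE H); apply: limr_le; first by apply/cvgP; exact: H.
by apply: nearW => T; exact: sum_hit_within_le1.
Qed.

Lemma walk_stop_in O x s h : walk_stop O x s = Some h -> h \in O.
Proof. by elim: s x => //= b s IHs x; case: ifP => [yO [<-]|_ /IHs]. Qed.

Lemma hit_within_notin T O x h : h \notin O -> hit_within T O x h = 0.
Proof.
move=> hO; rewrite /hit_within big1 // => s _; case: eqP => [/walk_stop_in|_].
  by rewrite (negbTE hO).
by rewrite mulr0.
Qed.

Lemma hit_notin O x h : h \notin O -> hit O x h = 0.
Proof.
move=> hO; apply: cvg_limE; under eq_fun do rewrite hit_within_notin //.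
exact: cvg_cst.
Qed.

(** Both rotations permute the sites and the two directions have total probability 1, so the sum
    over all starting sites absorbs the first step. *)
Lemma sum_hit_withinS T O h :
  \sum_y hit_within T.+1 O y h = \sum_y hit0_within T O y h.
Proof.
under eq_bigr => ? _ do rewrite hit_withinS.
rewrite big_split /= -!mulr_sumr.
have -> : \sum_y hit0_within T O (ordS y) h = \sum_y hit0_within T O y h.
  by rewrite [RHS](reindex (@ordS n)) //; exists (@ord_pred n) => y _;
    [exact: ordSK|exact: ord_predK].
have -> : \sum_y hit0_within T O (ord_pred y) h = \sum_y hit0_within T O y h.
  by rewrite [RHS](reindex (@ord_pred n)) //; exists (@ordS n) => y _;
    [exact: ord_predK|exact: ordSK].
by rewrite -mulrDl addrC subrK mul1r.
Qed.

End Cycle.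

(* Hitting probabilities within T steps on the segment {0, ..., e}, with boundary
   values a at 0 and b at e. *)
Fixpoint seg (a b : R) (T e k : nat) : R :=
  if k == 0%N then a else if k == e then b else
  if T is T'.+1 then p * seg a b T' e k.+1 + (1 - p) * seg a b T' e k.-1 else 0.

Lemma segE a b T e k : seg a b T.+1 e k =
  if k == 0%N then a else if k == e then b else
  p * seg a b T e k.+1 + (1 - p) * seg a b T e k.-1.
Proof. by []. Qed.

Lemma seg_0 a b T e : seg a b T e 0 = a.
Proof. by case: T. Qed.

Lemma seg_e a b T e : (0 < e)%N -> seg a b T e e = b.
Proof. by case: T => [|T] /=; case: e => // e _ /=; rewrite eqxx. Qed.

Lemma seg_lin a b T e k : seg a b T e k = a * seg 1 0 T e k + b * seg 0 1 T e k.
Proof.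
elim: T k => [|T IHT] k; last rewrite !segE; rewrite /=.
  by case: ifP => _; [|case: ifP => _]; lra.
case: ifP => _; [lra|case: ifP => _; first lra].
by rewrite !(IHT k.+1) !(IHT k.-1); lra.
Qed.

Lemma seg_ge0 a b T e k : 0 <= a -> 0 <= b -> 0 <= seg a b T e k.
Proof.
move=> a0 b0; elim: T k => [|T IHT] k /=.
  by case: ifP => // _; case: ifP.
by case: ifP => // _; case: ifP => // _; rewrite addr_ge0 // mulr_ge0.
Qed.

Lemma seg_le1 a b T e k : a <= 1 -> b <= 1 -> seg a b T e k <= 1.
Proof.
move=> a1 b1; elim: T k => [|T IHT] k /=.
  by case: ifP => // _; case: ifP.
case: ifP => // _; case: ifP => // _.
have := IHT k.+1; have := IHT k.-1; have := p0; have := q0; nra.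
Qed.

Lemma seg_homo a b T e k : 0 <= a -> 0 <= b -> seg a b T e k <= seg a b T.+1 e k.
Proof.
move=> a0 b0; elim: T k => [|T IHT] k.
  rewrite segE [leLHS]/=; case: ifP => // _; case: ifP => // _.
  by rewrite addr_ge0 // mulr_ge0 // seg_ge0.
rewrite (segE _ _ T) (segE _ _ T.+1); case: ifP => // _; case: ifP => // _.
by rewrite lerD // ler_wpM2l.
Qed.

Definition seg_lim a b e k : R := limn (fun T => seg a b T e k).

Lemma cvg_seg a b e k : 0 <= a <= 1 -> 0 <= b <= 1 ->
  (fun T => seg a b T e k) @ \oo --> seg_lim a b e k.
Proof.
move=> /andP[a0 a1] /andP[b0 b1].
apply: nondecreasing_is_cvgn; first by apply/nondecreasing_seqP => T; exact: seg_homo.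
by exists 1 => _ [T _ <-]; exact: seg_le1.
Qed.

(* Maximum principle: the probability of never leaving the segment vanishes. *)
Lemma seg_lim11 e k : (0 < e)%N -> (k <= e)%N -> seg_lim 1 1 e k = 1.
Proof.
move=> e0.
have b1 : 0 <= (1 : R) <= 1 by rewrite ler01 lexx.
have c j := @cvg_seg 1 1 e j b1 b1.
(* [w j] is the probability that the walk from [j] never leaves; it vanishes at both ends and is
   harmonic in between. *)
pose w j := 1 - seg_lim 1 1 e j.
have w0 : w 0%N = 0.
  rewrite /w; suff -> : seg_lim 1 1 e 0 = 1 by rewrite subrr.
  by apply: cvg_limE; under eq_fun do rewrite seg_0; exact: cvg_cst.
have we : w e = 0.
  rewrite /w; suff -> : seg_lim 1 1 e e = 1 by rewrite subrr.
  by apply: cvg_limE; under eq_fun do rewrite seg_e //; exact: cvg_cst.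
have wge j : 0 <= w j.
  rewrite subr_ge0; apply: limr_le; first by apply/cvgP; exact: c.
  by apply: nearW => T; exact: seg_le1.
have wh j : (0 < j < e)%N -> w j = p * w j.+1 + (1 - p) * w j.-1.
  move=> je; suff : seg_lim 1 1 e j = p * seg_lim 1 1 e j.+1 + (1 - p) * seg_lim 1 1 e j.-1.
    by rewrite /w => ->; lra.
  apply: cvg_limE; rewrite -(@cvg_shiftn 1) /=.
  have -> : (fun T => seg 1 1 (T + 1) e j) =
      (fun T => p * seg 1 1 T e j.+1 + (1 - p) * seg 1 1 T e j.-1).
    by apply/funext => T; rewrite addn1 segE !ifF //; apply/eqP; lia.
  by apply: cvgD; apply: cvgMl_tmp; exact: c.
suff H j : (j <= e)%N -> w j = 0.
  by move=> ke; have := H _ ke; rewrite /w => /eqP; rewrite subr_eq0 => /eqP <-.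
(* For [p = 0] the walk only moves left, so the value 0 spreads from the left end. *)
case: (eqVneq p 0) => [pz|pn0].
  elim: j => [//|j IHj] je; case: (eqVneq j.+1 e) => [->//|ne].
  by rewrite wh ?pz /= ?mul0r ?subr0 ?mul1r ?add0r ?IHj //; lia.
have pgt : 0 < p by rewrite lt_def pn0.
pose i0 : 'I_e.+1 := ord0.
(* Since [0 < p], a maximum of [w] propagates to the right neighbour, hence up to [e], where [w]
   vanishes. *)
have [i _ imax] := @arg_maxP _ _ _ i0 xpredT (fun i => w (val i)) isT.
have {}imax l : (l <= e)%N -> w l <= w i.
  by rewrite -ltnS => le; have := imax (Ordinal le) isT.
suff wi0 : w i = 0 by move=> je; apply/eqP; rewrite eq_le wge andbT -wi0 imax.
have key l : (i + l <= e)%N -> w (i + l)%N = w i.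
  elim: l => [|l IHl] il; first by rewrite addn0.
  have IH := IHl ltac:(lia); rewrite addnS.
  case: (posnP (i + l)) => [z|pos].
    apply/eqP; rewrite eq_le imax ?IH //=; last lia.
    by rewrite -IH z w0 wge.
  have := wh (i + l)%N ltac:(lia); rewrite IH => E.
  apply/eqP; rewrite eq_le imax /=; last lia.
  have a1 := imax (i + l).-1 ltac:(lia).
  have : p * w i <= p * w (i + l).+1 by have := ler_wpM2l q0 a1; lra.
  by rewrite ler_pM2l.
have il := ltn_ord i; rewrite -(key (e - i)%N) subnKC //.
Qed.

Lemma seg_limD e k : (0 < e)%N -> (k <= e)%N ->
  seg_lim 1 0 e k + seg_lim 0 1 e k = 1.
Proof.
move=> e0 ke; rewrite -[RHS](seg_lim11 e0 ke); apply/esym/cvg_limE.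
under eq_fun do rewrite seg_lin !mul1r.
have b0 : 0 <= (0 : R) <= 1 by rewrite lexx ler01.
have b1 : 0 <= (1 : R) <= 1 by rewrite ler01 lexx.
exact: cvgD (@cvg_seg 1 0 e k b1 b0) (@cvg_seg 0 1 e k b0 b1).
Qed.

(** * Holes hit from a uniform starting site *)

Section Kernel.
Variable n : nat.
Implicit Types (x y z h : 'I_n) (O S : {set 'I_n}).

(** Until it is stopped, the walk sees only the gap it started in. If [O] is a singleton both ends
    are the same hole and both boundary values can be 1. *)
Lemma hit0_within_gap T O a h k : a \in O -> (k <= next_dist O a)%N ->
  hit0_within T O (adv a k) h =
  seg (a == h)%:R (adv a (next_dist O a) == h)%:R T (next_dist O a) k.
Proof.
move=> aO; have [/andP[e0 en] eO nO] := next_distP aO.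
set e := next_dist O a in e0 en eO nO *.
elim: T k => [|T IHT] k ke.
  rewrite /hit0_within [seg _ _ _ _ _]/=; case: (eqVneq k 0%N) => [->|k0]; first by rewrite adv0 aO.
  case: (eqVneq k e) => [->|kE]; first by rewrite eO.
  by rewrite (negbTE (nO _ _)) ?hit_within0 //; lia.
rewrite /hit0_within segE; case: (eqVneq k 0%N) => [->|k0]; first by rewrite adv0 aO.
case: (eqVneq k e) => [->|kE]; first by rewrite eO.
rewrite (negbTE (nO _ _)); last lia.
rewrite hit_withinS ordS_adv ord_pred_adv; last lia.
by rewrite !IHT //; lia.
Qed.

(** This is [n] times the probability that a ball dropped at a uniform site fills [h]. *)
Definition hit_mass O h : R := \sum_y hit O y h.

(** Walks started in the gap after [a] fill [a] when they leave it to the left and the next hole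
    when they leave it to the right. *)
Lemma hit_massE O h : O != finset.set0 ->
  hit_mass O h = \sum_(a in O)
    ((a == h)%:R * \sum_(0 <= k < next_dist O a) seg_lim 1 0 (next_dist O a) k +
     (adv a (next_dist O a) == h)%:R *
       \sum_(0 <= k < next_dist O a) seg_lim 0 1 (next_dist O a) k).
Proof.
move=> O0.
have H1 : (fun T => \sum_y hit_within T O y h) @ \oo --> hit_mass O h.
  by apply: cvg_bigsum => y _; exact: cvg_hit.
rewrite -(@cvg_shiftn 1) /= in H1.
rewrite -(cvg_limE H1); apply: cvg_limE.
have -> : (fun T => \sum_y hit_within (T + 1) O y h) = (fun T =>
  \sum_(a in O)
    ((a == h)%:R * \sum_(0 <= k < next_dist O a) seg 1 0 T (next_dist O a) k +
     (adv a (next_dist O a) == h)%:R *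
       \sum_(0 <= k < next_dist O a) seg 0 1 T (next_dist O a) k)).
  apply/funext => T; rewrite addn1 sum_hit_withinS (sum_gaps _ O0).
  apply: eq_bigr => a aO; rewrite !mulr_sumr -big_split /=.
  apply: eq_big_nat => k /andP[_ /ltnW kl].
  by rewrite hit0_within_gap // seg_lin.
apply: cvg_bigsum => a _; apply: cvgD; apply: cvgMl_tmp; apply: cvg_bigsum => k _;
  apply: cvg_seg => //; by rewrite ?ler01 ?lexx.
Qed.

Section Insert.
Variables (S : {set 'I_n}) (x : 'I_n).
Hypothesis xS : x \in S.

(** Walks from the gap ahead of [h] fill it by leaving to the left, those from the gap behind by
    leaving to the right. *)
Lemma hit_mass_insert i : (0 < i < next_dist S x)%N ->
  hit_mass (adv x i |: S) (adv x i) =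
  \sum_(0 <= k < next_dist S x - i) seg_lim 1 0 (next_dist S x - i) k +
  \sum_(0 <= k < i) seg_lim 0 1 i k.
Proof.
move=> il; set O := _ |: S; set h := adv x i.
have hO : h \in O by rewrite finset.setU11.
have xO : x \in O by rewrite finset.setU1r.
rewrite hit_massE; last by apply/finset.set0Pn; exists h.
rewrite big_split /=; congr (_ + _).
  rewrite (bigD1 h) //= eqxx mul1r [X in _ + X]big1 ?addr0 ?next_dist_insert_new //.
  by move=> a /andP[_ /negbTE ->]; rewrite mul0r.
have nx : next_dist O x = i := next_dist_insert_left xS il.
rewrite (bigD1 x xO) /= nx -/h eqxx mul1r [X in _ + X]big1 ?addr0 //.
(* Two gaps ending at [h] would share the site just behind [h], so only the gap after [x] ends
   there. *)
move=> a /andP[aO ax]; case: eqP => [E|]; last by rewrite mul0r.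
have [/andP[a0 _] _ _] := next_distP aO; have [/andP[x0 _] _ _] := next_distP xO.
have [] := @adv_gap_inj _ O a x (next_dist O a).-1 (next_dist O x).-1 aO xO.
- by rewrite prednK.
- by rewrite prednK.
- by rewrite -!ord_pred_adv // E nx.
by move=> ax'; rewrite ax' eqxx in ax.
Qed.

(* Reflecting h inside its gap turns exits to the right into exits to the left. *)
Lemma hit_mass_reflect i : (0 < i < next_dist S x)%N ->
  hit_mass (adv x i |: S) (adv x i) +
  hit_mass (adv x (next_dist S x - i) |: S) (adv x (next_dist S x - i)) =
  (next_dist S x)%:R.
Proof.
move=> il; rewrite !hit_mass_insert //; last lia.
rewrite subKn; last lia.
rewrite [X in _ + X]addrC addrACA [X in _ + X]addrC -!big_split /=.
(* Left and right exits from a segment of length [e] add up to [e], as the walk leaves almost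
   surely; the two segments have lengths [d - i] and [i]. *)
have H e : (0 < e)%N ->
    \sum_(0 <= k < e) (seg_lim 1 0 e k + seg_lim 0 1 e k) = e%:R.
  move=> e0; rewrite (eq_big_nat _ _ (F2 := fun=> 1)) => [|k /andP[_ /ltnW ke]].
    by rewrite sumr_const_nat subn0.
  exact: seg_limD.
rewrite !H; [rewrite -natrD; congr _%:R; lia|lia|lia].
Qed.

End Insert.
End Kernel.
End Walk.
Arguments hit {R} p {n} O x h.

(** * Reduction to independent uniform balls *)

Section Chain.
Variables (R : realType) (n : nat).
Implicit Types (x y h : 'I_n) (O S : {set 'I_n}) (K : {set 'I_n} -> 'I_n -> 'I_n -> R).

(** Probability that balls starting at the sites of [t], in this order, turn the unfilled holes [O]
    into [S]. The kernel [K] is left free so as to cover both truncated and unlimited walks. *)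
Fixpoint chain K O (t : seq 'I_n) S : R :=
  if t is x :: t' then \sum_h K O x h * chain K (O :\ h) t' S else (O == S)%:R.

Lemma chain_ge0 K O t S : (forall O x h, 0 <= K O x h) -> 0 <= chain K O t S.
Proof.
move=> K0; elim: t O => [|x t IHt] O //=; apply: sumr_ge0 => h _.
by rewrite mulr_ge0.
Qed.

Lemma sum_chain_le1 K O t : (forall O x h, 0 <= K O x h) ->
  (forall O x, \sum_h K O x h <= 1) -> \sum_S chain K O t S <= 1.
Proof.
move=> K0 K1; elim: t O => [|x t IHt] O /=.
  rewrite (bigD1 O) //= eqxx [X in _ + X]big1 ?addr0 // => S /negbTE.
  by rewrite eq_sym => ->.
rewrite exchange_big /=; apply: le_trans (K1 O x); apply: ler_sum => h _.
by rewrite -mulr_sumr ler_piMr.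
Qed.

(** The induction on the number of balls conditions on the last ball, while [chain] unfolds from the
    first. *)
Lemma chain_rcons K O t x S :
  chain K O (rcons t x) S =
  \sum_S' chain K O t S' * \sum_h K S' x h * (S' :\ h == S)%:R.
Proof.
elim: t O => [|y t IHt] O /=.
  rewrite (bigD1 O) //= eqxx mul1r [X in _ + X]big1 ?addr0 // => S' /negbTE.
  by rewrite eq_sym => ->; rewrite mul0r.
under eq_bigr => h _ do rewrite IHt mulr_sumr.
rewrite exchange_big /=; apply: eq_bigr => S' _; rewrite mulr_suml.
by apply: eq_bigr => h _; rewrite mulrA.
Qed.

Lemma chain_card K O t S : (forall O x h, h \notin O -> K O x h = 0) ->
  chain K O t S != 0 -> #|O| = (size t + #|S|)%N.
Proof.
move=> K0; elim: t O => [|x t IHt] O /=.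
  by case: (O =P S) => [->|]; rewrite ?eqxx.
move=> /eqP; apply: contra_not_eq => neq; apply: big1 => h _.
have [hO|hO] := boolP (h \in O); last by rewrite K0 // mul0r.
have -> : chain K (O :\ h) t S = 0; last by rewrite mulr0.
apply/eqP/negPn/negP => /IHt e; move/eqP: neq; apply.
by rewrite (cardsD1 h O) hO e addnA.
Qed.

Lemma cvg_chain (K_ : nat -> {set 'I_n} -> 'I_n -> 'I_n -> R) K O t S :
  (forall O x h, (fun T => K_ T O x h) @ \oo --> K O x h) ->
  (fun T => chain (K_ T) O t S) @ \oo --> chain K O t S.
Proof.
move=> KK; elim: t O => [|x t IHt] O /=; first exact: cvg_cst.
by apply: cvg_bigsum => h _; apply: cvgM; [exact: KK|exact: IHt].
Qed.

Variable p : R.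

(** Each ball uses its own row of steps, so the sum over all rows factorises ball by ball. *)
Lemma golf_run_chain T O (t : seq 'I_n) S :
  \sum_(ws : (size t).-tuple (T.-tuple bool))
     (\prod_(s <- ws) steps_weight p s) *
     (golf_run O (zip t (map val ws)) == Some S)%:R =
  chain (hit_within p T) O t S.
Proof.
elim: t O => [|x t IHt] O /=.
  rewrite (big_pred1 [tuple]) /=; last by move=> w; apply/esym/eqP; exact: tuple0.
  by rewrite big_nil mul1r (inj_eq Some_inj).
rewrite (sum_tuple_cons (fun ws : seq (T.-tuple bool) =>
  (\prod_(s <- ws) steps_weight p s) *
     (golf_run O (zip (x :: t) (map val ws)) == Some S)%:R)) /=.
under [RHS]eq_bigr do rewrite /hit_within mulr_suml.
rewrite [RHS]exchange_big /=; apply: eq_bigr => a _.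
under eq_bigr do rewrite big_cons -mulrA.
rewrite -mulr_sumr; under [RHS]eq_bigr do rewrite -mulrA.
rewrite -mulr_sumr; congr (_ * _).
case: (walk_stop O x a) => [h0|]; last first.
  by rewrite !big1 // => *; rewrite ?mulr0 ?mul0r.
rewrite IHt (bigD1 h0) //= eqxx mul1r [X in _ + X]big1 ?addr0 // => h /negbTE hh.
by rewrite (inj_eq Some_inj) eq_sym hh mul0r.
Qed.

End Chain.

(** * Initial configurations with ordered balls *)

Section Starts.
Variables (n Nb Nh : nat).
Implicit Types (q : Nb.-tuple 'I_n * {set 'I_n}).

(** The ordered list of balls determines their set, so such a pair amounts to a configuration with a
    clock order. *)
Definition valid_start q : bool :=
  [&& uniq q.1, #|q.2| == Nh & all (fun x => x \notin q.2) q.1].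

Definition any_start q : bool := #|q.2| == Nh.

Lemma sum_valid_config (V : nmodType) (F : Nb.-tuple 'I_n -> {set 'I_n} -> V) :
  \sum_(c : {set 'I_n} * {set 'I_n} | valid_config Nb Nh c)
     \sum_(t : Nb.-tuple 'I_n | clock_order c.1 t) F t c.2 =
  \sum_(q | valid_start q) F q.1 q.2.
Proof.
rewrite pair_big_dep /=.
rewrite (reindex_onto
  (fun q => (([set x | x \in q.1]%SET, q.2), q.1) : ({set 'I_n} * {set 'I_n}) * Nb.-tuple 'I_n)
  (fun ct : ({set 'I_n} * {set 'I_n}) * Nb.-tuple 'I_n => (ct.2, ct.1.2))) /=; last first.
  by move=> [[B O] t] /= /andP[_ /andP[_ /eqP <-]].
apply: eq_bigl => -[t O] /=; rewrite eqxx andbT /clock_order eqxx andbT.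
rewrite /valid_config /valid_start /= cardsE disjoint_subset.
have [ut|] := boolP (uniq t); last by rewrite andbF.
rewrite (card_uniqP ut) size_tuple eqxx /= andbT; congr (_ && _).
apply/fintype.subsetP/allP => H x; last by rewrite inE => /H.
by move=> xt; have := H x; rewrite inE; apply.
Qed.

Lemma card_clock_order (B : {set 'I_n}) : #|B| = Nb ->
  #|[set t : Nb.-tuple 'I_n | clock_order B t]%SET| = Nb`!.
Proof.
move=> BN; rewrite -ffactnn -[in RHS]BN -card_uniq_tuples BN.
apply: eq_card => t; rewrite !inE /clock_order andbC.
have [ut|] := boolP (uniq t); last by rewrite !andbF.
rewrite !andbT; apply/eqP/allP => [-> x|H].
  by move=> xt; have : x \in [set x0 | x0 \in t]%SET by rewrite inE.
apply/eqP; rewrite eq_sym eqEcard cardsE (card_uniqP ut) size_tuple BN leqnn andbT.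
by apply/fintype.subsetP => x; rewrite inE => /H.
Qed.

Lemma card_valid_start :
  #|[set q | valid_start q]%SET| = ('C(n, Nh) * (n - Nh) ^_ Nb)%N.
Proof.
rewrite -sum1dep_card.
transitivity (\sum_(O : {set 'I_n} | #|O| == Nh)
   \sum_(t : Nb.-tuple 'I_n | all (mem (~: O)) t && uniq t) 1)%N.
  rewrite pair_big_dep /= (reindex (fun q : {set 'I_n} * Nb.-tuple 'I_n => (q.2, q.1))) /=.
    apply: eq_bigl => -[Q t]; rewrite /valid_start /= andbCA [X in _ && X]andbC.
    congr (_ && (_ && _)); apply: eq_all => x; by rewrite !inE.
  by exists (fun q => (q.2, q.1)) => -[].
rewrite (eq_bigr (fun=> ((n - Nh) ^_ Nb)%N)) => [|O /eqP ON].
  by rewrite sum_nat_const; congr (_ * _)%N; rewrite -[in RHS](card_ord n) -card_draws cardsE.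
by rewrite sum1dep_card card_uniq_tuples cardsCs finset.setCK card_ord ON.
Qed.

Lemma card_any_start : #|[set q | any_start q]%SET| = ('C(n, Nh) * n ^ Nb)%N.
Proof.
rewrite -sum1dep_card.
transitivity (\sum_(O : {set 'I_n} | #|O| == Nh) \sum_(t : Nb.-tuple 'I_n) 1)%N.
  rewrite pair_big_dep /= (reindex (fun q : {set 'I_n} * Nb.-tuple 'I_n => (q.2, q.1))) /=.
    by apply: eq_bigl => -[Q t]; rewrite /any_start /= andbT.
  by exists (fun q => (q.2, q.1)) => -[].
rewrite (eq_bigr (fun=> (n ^ Nb)%N)) => [|O _].
  by rewrite sum_nat_const; congr (_ * _)%N; rewrite -[in RHS](card_ord n) -card_draws cardsE.
by rewrite sum1_card card_tuple card_ord.
Qed.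

Lemma valid_any q : valid_start q -> any_start q.
Proof. by case/and3P. Qed.

(** Every configuration has [Nb!] clock orders, so a uniform configuration with a uniform order is a
    uniform valid start. *)
Lemma card_config_start :
  (#|[set c : {set 'I_n} * {set 'I_n} | valid_config Nb Nh c]%SET| * Nb`!)%N =
  #|[set q | valid_start q]%SET|.
Proof.
rewrite -!sum1dep_card -(sum_valid_config (fun _ _ => 1%N)) big_distrl /=.
apply: eq_bigr => c /and3P[/eqP cB _ _].
by rewrite mul1n sum1dep_card card_clock_order.
Qed.

End Starts.

Section Expectation.
Variables (R : realType) (p : R).
Hypothesis p01 : 0 <= p <= 1.
Variables (n Nb Nh : nat).

(** The number of orders is the same for all configurations, the walks are independent, and the
    limit in [T] passes through finite sums and products. *)
Lemma golf_probE (S : {set 'I_n}) : golf_prob Nb Nh p S =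
  (#|[set q : Nb.-tuple 'I_n * {set 'I_n} | valid_start Nh q]%SET|%:R)^-1 *
  \sum_(q : Nb.-tuple 'I_n * {set 'I_n} | valid_start Nh q) chain (hit p) q.2 q.1 S.
Proof.
apply: cvg_limE; rewrite /golf_prob_T.
have -> : (fun T => golf_prob_T Nb Nh p T S) = (fun T =>
  (#|[set q : Nb.-tuple 'I_n * {set 'I_n} | valid_start Nh q]%SET|%:R)^-1 *
  \sum_(q : Nb.-tuple 'I_n * {set 'I_n} | valid_start Nh q)
    chain (hit_within p T) q.2 q.1 S).
  apply/funext => T; rewrite /golf_prob_T.
  rewrite -(sum_valid_config Nh (fun t O => chain (hit_within p T) O t S)).
  rewrite -card_config_start natrM invfM -mulrA !mulr_sumr.
  apply: eq_bigr => c /and3P[/eqP cB _ _]; congr (_ * _).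
  rewrite mulr_sumr; apply: eq_bigr => t _.
  rewrite card_clock_order //; congr (_ * _).
  have := @golf_run_chain R n p T c.2 (val t) S; rewrite /= size_tuple => <-.
  rewrite (reindex (fun ws : Nb.-tuple (T.-tuple bool) => [ffun j => tnth ws j])) /=.
    apply: eq_bigr => ws _; congr (_ * _).
      by rewrite big_tuple; apply: eq_bigr => j _; rewrite ffunE.
    congr ((golf_run _ (zip _ _) == _)%:R).
    rewrite -[in RHS](map_tnth_enum ws) -map_comp.
    by apply: eq_map => j /=; rewrite ffunE.
  exists (fun w : {ffun 'I_Nb -> T.-tuple bool} => [tuple w j | j < Nb]) => w _.
    by apply: eq_from_tnth => j; rewrite tnth_mktuple ffunE.
  by apply/ffunP => j; rewrite ffunE tnth_mktuple.
apply: cvgMl_tmp; apply: cvg_bigsum => q _; apply: cvg_chain => O x h.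
exact: cvg_hit.
Qed.

(* Balls dropped at arbitrary sites, even on holes or on top of each other; to be
   divided by 'C(n, Nh) * n ^ Nb to get a probability. *)
Definition drop_mass (S : {set 'I_n}) : R :=
  \sum_(t : Nb.-tuple 'I_n) \sum_(O : {set 'I_n} | #|O| == Nh) chain (hit p) O t S.

End Expectation.

(** With [a] and [b] elements, the two weights differ by [1 / b - 1 / a] on [B] and by [1 / a] on
    the rest of [A]; these differences sum to [2 * (1 - b / a)]. *)
Lemma average_subset (R : realType) (I : finType) (A B : pred I) (E : I -> R) (M : R) :
  (forall i, B i -> A i) -> (0 < #|B|)%N -> (forall i, `|E i| <= M) ->
  `| (#|B|%:R)^-1 * (\sum_(i | B i) E i) - (#|A|%:R)^-1 * (\sum_(i | A i) E i) | <=
  2 * M * (1 - #|B|%:R / #|A|%:R).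
Proof.
move=> BA B0 EM; set b : R := #|B|%:R; set a : R := #|A|%:R.
have BAc : (#|B| <= #|A|)%N by apply: subset_leq_card; apply/fintype.subsetP.
have b0 : 0 < b by rewrite ltr0n.
have a0 : 0 < a by rewrite ltr0n (leq_trans B0).
have ab : b <= a by rewrite ler_nat.
have -> : \sum_(i | B i) E i = \sum_(i | A i) (B i)%:R * E i.
  rewrite big_mkcond [RHS]big_mkcond; apply: eq_bigr => i _.
  case Bi: (B i); last by rewrite mul0r if_same.
  by rewrite BA // mul1r.
rewrite !mulr_sumr -sumrB.
apply: le_trans (ler_norm_sum _ _ _) _.
apply: (@le_trans _ _ (\sum_(i | A i) M * (a^-1 + (B i)%:R * (b^-1 - 2 * a^-1)))).
  apply: ler_sum => i _; rewrite mulrA -mulrBl normrM mulrC.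
  apply: ler_pM => //; case: (B i) => /=.
    have : a^-1 <= b^-1 by rewrite lef_pV2.
    by rewrite mulr1 mul1r => ?; rewrite ger0_norm ?subr_ge0 //; lra.
  by rewrite mulr0 sub0r mul0r addr0 normrN gtr0_norm ?invr_gt0.
rewrite -mulr_sumr big_split /= -mulr_suml.
have -> : \sum_(i | A i) (B i)%:R = b :> R.
  rewrite /b -sum1_card natr_sum big_mkcond [RHS]big_mkcond; apply: eq_bigr => i _.
  have -> : (i \in B) = B i by []. by case Bi: (B i) => //=; [rewrite BA|rewrite if_same].
rewrite sumr_const -[in X in X + _]mulr_natr -/a.
rewrite le_eqVlt; apply/orP; left; apply/eqP; field.
by rewrite !gt_eqF.
Qed.

(** * The mass of a set of remaining holes *)

Section GapPoly.
Variable R : numFieldType.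

Definition antideriv1 (q : {poly R}) : {poly R} :=
  \poly_(i < (size q).+1) (if i is i'.+1 then q`_i' / i'.+1%:R else 1).

Lemma antideriv1_0 q : (antideriv1 q)`_0 = 1.
Proof. by rewrite coef_poly. Qed.

Lemma deriv_antideriv1 q : (antideriv1 q)^`() = q.
Proof.
apply/polyP => i; rewrite coef_deriv coef_poly ltnS.
case: ltnP => [_|qi]; last by rewrite mul0rn nth_default.
by rewrite -[LHS]mulr_natr divfK // pnatr_eq0.
Qed.

(* The table A_0, ..., A_d: the recursion for A_(d + 1) uses all smaller indices. *)
Fixpoint gap_polys d : seq {poly R} :=
  if d is d'.+1 then let s := gap_polys d' in
    rcons s (antideriv1 ((d'.+1%:R / 2) *: \sum_(1 <= i < d'.+1) s`_i * s`_(d'.+1 - i)))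
  else [:: 1].

Definition gap_poly d : {poly R} := (gap_polys d)`_d.

Lemma size_gap_polys d : size (gap_polys d) = d.+1.
Proof. by elim: d => //= d IHd; rewrite size_rcons IHd. Qed.

Lemma nth_gap_polys d i : (i <= d)%N -> (gap_polys d)`_i = gap_poly i.
Proof.
elim: d => [|d IHd]; first by rewrite leqn0 => /eqP ->.
rewrite leq_eqVlt => /orP[/eqP ->//|id].
by rewrite /= nth_rcons size_gap_polys id IHd.
Qed.

Lemma coef0_gap_poly d : (gap_poly d)`_0 = 1.
Proof.
case: d => [|d]; first by rewrite /gap_poly /= coef1.
by rewrite /gap_poly /= nth_rcons size_gap_polys ltnn eqxx antideriv1_0.
Qed.

Lemma deriv_gap_poly d : (gap_poly d)^`() =
  (d%:R / 2) *: \sum_(1 <= i < d) gap_poly i * gap_poly (d - i).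
Proof.
case: d => [|d]; first by rewrite /gap_poly /= -[1]/(1%:P) derivC mul0r scale0r.
rewrite [in LHS]/gap_poly /= nth_rcons size_gap_polys ltnn eqxx deriv_antideriv1.
congr (_ *: _); apply: eq_big_nat => i id.
by rewrite !nth_gap_polys //; lia.
Qed.

Lemma deriv_prod (I : finType) (S : {set I}) (F : I -> {poly R}) :
  (\prod_(x in S) F x)^`() =
  \sum_(x in S) (F x)^`() * \prod_(y in S :\ x) F y.
Proof.
move: {2}#|S| (erefl #|S|) => k; elim: k S => [|k IHk] S kS.
  by rewrite (cards0_eq kS) !big_set0 -[1]/(1%:P) derivC.
have [x0 x0S] : exists x, x \in S by apply/card_gt0P; rewrite kS.
have kS' : #|S :\ x0| = k by move: kS; rewrite (cardsD1 x0) x0S => -[].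
rewrite !(big_setD1 x0 x0S) /= derivM (IHk _ kS') mulr_sumr; congr (_ + _).
apply: eq_bigr => x xS; rewrite mulrCA; congr (_ * _).
have x0S' : x0 \in S :\ x.
  by move: xS; rewrite !inE x0S eq_sym => /andP[-> _].
rewrite (big_setD1 x0 x0S') /=; congr (_ * _); apply: eq_bigl => y.
by rewrite !inE andbCA.
Qed.

End GapPoly.

(** Averaging the sum with its reversal replaces [u] by its mean [D / 2]. Applied to hitting masses,
    this removes [p]. *)
Lemma sum_symmetric (R : numFieldType) (d : nat) (c u : nat -> R) (D : R) :
  (forall i, (0 < i < d)%N -> c (d - i)%N = c i) ->
  (forall i, (0 < i < d)%N -> u i + u (d - i)%N = D) ->
  \sum_(1 <= i < d) c i * u i = D / 2 * \sum_(1 <= i < d) c i.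
Proof.
move=> cs us; set s := LHS.
have : s = \sum_(1 <= i < d) c i * u (d - i)%N.
  rewrite /s big_nat_rev /=; apply: eq_big_nat => i id.
  by rewrite add1n subSS cs.
move=> s2; have : s + s = D * \sum_(1 <= i < d) c i.
  rewrite {2}s2 -big_split mulr_sumr /=; apply: eq_big_nat => i id.
  by rewrite -mulrDr us // mulrC.
by move=> e; rewrite mulrAC -e; field.
Qed.

Lemma sum_tuple_rcons (V : nmodType) (X : finType) (T : nat) (F : seq X -> V) :
  \sum_(t : T.+1.-tuple X) F t = \sum_(a : X) \sum_(t : T.-tuple X) F (rcons t a).
Proof.
have rv k (G : seq X -> V) : \sum_(t : k.-tuple X) G t = \sum_(t : k.-tuple X) G (rev t).
  rewrite (reindex_inj (h := fun t : k.-tuple X => [tuple of rev t])) //=.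
  by move=> t t' /(congr1 val) /= /(can_inj revK) ?; apply: val_inj.
rewrite (rv T.+1 F) (sum_tuple_cons (fun t => F (rev t))); apply: eq_bigr => a _.
by rewrite [RHS](rv T (fun t => F (rcons t a))); apply: eq_bigr => t _; rewrite rev_cons.
Qed.

Arguments sum_tuple_rcons {V X T} F.

Section DropMass.
Variables (R : realType) (p : R).
Hypothesis p01 : 0 <= p <= 1.
Variables (n Nh : nat).
Implicit Types (x y h : 'I_n) (O S : {set 'I_n}).

Lemma drop_mass0 S : drop_mass p 0 Nh S = (#|S| == Nh)%:R.
Proof.
rewrite /drop_mass (big_pred1 [tuple]); last by move=> w; apply/esym/eqP; exact: tuple0.
rewrite /= big_mkcond (bigD1 S) //= eqxx [X in _ + X]big1 ?addr0; first by case: ifP.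
by move=> O /negbTE ->; rewrite if_same.
Qed.

(** The last ball fills some [h] outside [S], having found the holes [h |: S]; summing over its
    starting site gives [hit_mass]. *)
Lemma drop_massS k S : drop_mass p k.+1 Nh S =
  \sum_(h | h \notin S) drop_mass p k Nh (h |: S) * hit_mass p (h |: S) h.
Proof.
rewrite /drop_mass (sum_tuple_rcons (fun t => \sum_(O : {set 'I_n} | #|O| == Nh) chain (hit p) O t S)).
transitivity (\sum_S' drop_mass p k Nh S' *
    \sum_h hit_mass p S' h * (S' :\ h == S)%:R).
  under [LHS]eq_bigr => a _ do under eq_bigr => t _ do
    under eq_bigr => O _ do rewrite chain_rcons.
  under [LHS]eq_bigr => a _ do under eq_bigr => t _ do rewrite exchange_big /=.
  under [LHS]eq_bigr => a _ do rewrite exchange_big /=.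
  rewrite exchange_big /=; apply: eq_bigr => S' _.
  rewrite /drop_mass mulr_suml [LHS]exchange_big /=; apply: eq_bigr => t _.
  rewrite mulr_suml [LHS]exchange_big /=; apply: eq_bigr => O _.
  rewrite -mulr_sumr; congr (_ * _); rewrite exchange_big /=.
  by apply: eq_bigr => h _; rewrite /hit_mass mulr_suml.
under eq_bigr => S' _ do rewrite mulr_sumr.
rewrite exchange_big /= [RHS]big_mkcond; apply: eq_bigr => h _.
have [hS|hS] := boolP (h \in S); rewrite /=.
  rewrite big1 // => S' _; case: eqP => [E|_]; last by rewrite !mulr0.
  by move: hS; rewrite -E !inE eqxx.
rewrite (bigD1 (h |: S)) //= setU1K // eqxx mulr1 [X in _ + X]big1 ?addr0 // => S' S'n.
case: eqP => [E|_]; last by rewrite !mulr0.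
(* Either [S'] contains [h] and is [h |: S], or [h] is not a hole of [S'] and cannot be hit. *)
have [hS'|hS'] := boolP (h \in S'); first by rewrite -E finset.setD1K ?eqxx in S'n.
by rewrite /hit_mass big1 ?mul0r ?mulr0 // => y _; rewrite hit_notin.
Qed.

Definition gap_prod S : {poly R} := \prod_(x in S) gap_poly R (next_dist S x).

Lemma gap_prod_insert S x i : x \in S -> (0 < i < next_dist S x)%N ->
  gap_prod (adv x i |: S) = gap_poly R i * gap_poly R (next_dist S x - i) *
    \prod_(y in S :\ x) gap_poly R (next_dist S y).
Proof.
move=> xS il; rewrite /gap_prod big_setU1 ?insert_notin //=.
rewrite next_dist_insert_new // (big_setD1 x xS) /= next_dist_insert_left //.
rewrite mulrCA mulrA; congr (_ * _); apply: eq_bigr => y; rewrite !inE => /andP[yx yS].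
by rewrite next_dist_insert_other.
Qed.

(** The last hole filled cuts a gap of length [d] into [i] and [d - i], symmetry replaces its
    hitting mass by [d / 2], and the sum over the gaps is the Leibniz rule for the derivative of
    [gap_prod S]. *)
Lemma drop_massE k S : S != finset.set0 -> (#|S| + k)%N = Nh ->
  drop_mass p k Nh S = k`!%:R * (gap_prod S)`_k.
Proof.
elim: k S => [|k IHk] S S0 Sk.
  rewrite drop_mass0 -Sk addn0 eqxx mul1r /gap_prod coef0_prod big1 // => x _.
  exact: coef0_gap_poly.
rewrite drop_massS (sum_notin _ S0).
pose rest x := \prod_(y in S :\ x) gap_poly R (next_dist S y).
pose c x i := k`!%:R * (gap_poly R i * gap_poly R (next_dist S x - i) * rest x)`_k.
transitivity (\sum_(x in S) (next_dist S x)%:R / 2 *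
    \sum_(1 <= i < next_dist S x) c x i).
  apply: eq_bigr => x xS.
  rewrite -(sum_symmetric (u := fun i => hit_mass p (adv x i |: S) (adv x i))).
  - apply: eq_big_nat => i id; rewrite IHk ?gap_prod_insert //.
      by apply/finset.set0Pn; exists x; rewrite finset.setU1r.
    by rewrite cardsU1 insert_notin // -Sk /= add1n addSn addnS.
  - move=> i id; rewrite /c subKn; last lia.
    by rewrite [gap_poly R (_ - i) * _]mulrC.
  - by move=> i id; rewrite (hit_mass_reflect p01 xS).
have -> : (k.+1)`!%:R * (gap_prod S)`_k.+1 = k`!%:R * ((gap_prod S)^`())`_k.
  by rewrite coef_deriv factS natrM; ring.
rewrite deriv_prod.
rewrite coef_sum mulr_sumr; apply: eq_bigr => x xS.
rewrite deriv_gap_poly -[in RHS]scalerAl coefZ mulrCA; congr (_ * _).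
by rewrite -mulr_sumr mulr_suml coef_sum.
Qed.

Lemma drop_mass_card k S : drop_mass p k Nh S != 0 -> (#|S| + k)%N = Nh.
Proof.
move=> nz; apply/eqP/negPn/negP => e; move/eqP: nz; apply.
rewrite /drop_mass big1 // => t _; rewrite big1 // => O /eqP ON.
have [->//|/chain_card H] := eqVneq (chain (hit p) O t S) 0.
have {}H := H (fun O x h => @hit_notin R p n O x h).
by case/negP: e; rewrite -ON H size_tuple addnC.
Qed.

End DropMass.

(** * Asymptotics of the gap polynomials *)

(** Both sides count the subsets with [a + b + 1] elements of a chain of [D + 1]; on the left they
    are sorted by their element of rank [a + 1], which has [i] elements below it. *)
Lemma sum_bin_bin (D a b : nat) :
  (\sum_(0 <= i < D.+1) 'C(i, a) * 'C(D - i, b) = 'C(D.+1, (a + b).+1))%N.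
Proof.
elim: D a b => [|D IHD] a [|b].
- by rewrite big_nat1 bin0 muln1 addn0; case: a.
- by rewrite big_nat1 [X in (_ * X)%N]bin_small // muln0 bin_small //; lia.
- under eq_bigr do rewrite bin0 muln1.
  rewrite big_nat_recr //= addn0 [RHS]binS; congr (_ + _)%N.
  rewrite -[in RHS](addn0 a) -(IHD a 0%N).
  by apply: eq_bigr => i _; rewrite bin0 muln1.
- rewrite big_nat_recr //= subnn [X in (_ * X)%N]bin_small // muln0 addn0.
  rewrite (eq_big_nat _ _ (F2 := fun i =>
    ('C(i, a) * 'C(D - i, b.+1) + 'C(i, a) * 'C(D - i, b))%N)); last first.
    by move=> i /andP[_ iD]; rewrite subSn // binS mulnDr.
  by rewrite big_split /= !IHD addnS -binS.
Qed.

(** * Catalan numbers and their convolution *)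

Section Catalan.
Variable R : realFieldType.

Definition catalan (b : nat) : R := (2 * b)`!%:R / (b`! * b.+1`!)%:R.

Lemma catalan0 : catalan 0 = 1.
Proof. by rewrite /catalan muln0 !fact0 mul1n divr1. Qed.

Lemma catalan_ge0 b : 0 <= catalan b.
Proof. by rewrite /catalan divr_ge0. Qed.

Lemma catalanS b : (b%:R + 2) * catalan b.+1 = (4 * b%:R + 2) * catalan b.
Proof.
rewrite /catalan.
have -> : (2 * b.+1)%N = (2 * b).+2 by lia.
rewrite !factS !natrM.
have nf k : k`!%:R != 0 :> R by rewrite pnatr_eq0 -lt0n fact_gt0.
have nS k : k.+1%:R != 0 :> R by rewrite pnatr_eq0.
have e1 : (2 * b).+2%:R = 2 * b%:R + 2 :> R by rewrite -addn2 natrD natrM.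
have e2 : (2 * b).+1%:R = 2 * b%:R + 1 :> R by rewrite -addn1 natrD natrM.
have e3 : b.+1%:R = b%:R + 1 :> R by rewrite -addn1 natrD.
have e4 : b.+2%:R = b%:R + 2 :> R by rewrite -addn2 natrD.
have := nS b; have := nS b.+1; have := nf b; rewrite e1 e2 e3 e4 => n1 n2 n3.
field; by rewrite n1 n2 n3.
Qed.

(** Induction through the two-term recursion [catalanS]: the convolution weighted by [i + 1] is
    evaluated in two ways. *)
Lemma catalan_conv b : \sum_(i < b.+1) catalan i * catalan (b - i) = catalan b.+1.
Proof.
elim: b => [|b IHb].
  rewrite big_ord_recl big_ord0 subnn catalan0 addr0 mul1r.
  by have := catalanS 0; rewrite catalan0; lra.
set S1 := LHS.
have flip k (G : nat -> nat -> R) :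
    \sum_(i < k.+1) G i (k - i)%N = \sum_(i < k.+1) G (k - i)%N i.
  rewrite (reindex_inj rev_ord_inj) /=; apply: eq_bigr => i _.
  by rewrite subSS subKn // -ltnS.
(* Exchanging [i] and [k - i] shows that the mean index is [k / 2]. *)
have half k : 2 * (\sum_(i < k.+1) i%:R * (catalan i * catalan (k - i))) =
    k%:R * \sum_(i < k.+1) catalan i * catalan (k - i).
  rewrite mulr_natl mulr2n {2}(flip k (fun i j => i%:R * (catalan i * catalan j))).
  rewrite -big_split mulr_sumr; apply: eq_bigr => i _ /=.
  have ik : (i <= k)%N by rewrite -ltnS.
  by rewrite natrB //; ring.
(* First evaluation: the recursion lowers the index [i] and leads back to the convolution of order
   [b]. *)
have E : \sum_(i < b.+2) (i%:R + 1) * (catalan i * catalan (b.+1 - i)) =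
    catalan b.+1 + 2 * (b%:R + 1) * catalan b.+1.
  rewrite big_ord_recl /= add0r catalan0 !mul1r subn0; congr (_ + _).
  transitivity (\sum_(i < b.+1) ((4 * (i%:R * (catalan i * catalan (b - i)))) + 2 * (catalan i * catalan (b - i)))).
    apply: eq_bigr => i _; rewrite /bump /= add1n subSS.
    rewrite mulrA (_ : i.+1%:R + 1 = i%:R + 2); last by rewrite -addn1 natrD; ring.
    by rewrite catalanS; ring.
  rewrite big_split -!mulr_sumr /= -IHb.
  have := half b; set x := \sum_(i < _) _ ; set y := \sum_(i < _) _ => h.
  have -> : 4 * x = 2 * (2 * x) by ring.
  by rewrite h; ring.
have E2 : \sum_(i < b.+2) (i%:R + 1) * (catalan i * catalan (b.+1 - i)) =
    (b%:R + 3) / 2 * S1.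
  under eq_bigr do rewrite mulrDl mul1r.
  rewrite big_split /= -/S1; have := half b.+1; rewrite -/S1.
  set x := \sum_(i < _) _ => h.
  have -> : x = b.+1%:R * S1 / 2 by rewrite -h; field.
  by rewrite -addn1 natrD; field.
have b3 : b%:R + 3 != 0 :> R by rewrite -natrD pnatr_eq0 addn3.
apply: (mulfI b3).
have -> : (b%:R + 3) * S1 = 2 * ((b%:R + 3) / 2 * S1) by field.
rewrite -E2 E.
have -> : (b%:R + 3) * catalan b.+2 = (b.+1%:R + 2) * catalan b.+2.
  by rewrite -addn1 natrD; ring.
by rewrite catalanS -addn1 natrD; ring.
Qed.

End Catalan.

Lemma ler_sum_subrange (R : numDomainType) (f : nat -> R) (m n k : nat) :
  (forall i, 0 <= f i) -> (m <= n)%N -> (n <= k)%N ->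
  \sum_(m <= i < n) f i <= \sum_(0 <= i < k) f i.
Proof.
move=> f0 mn nk.
rewrite (@big_cat_nat _ _ _ m 0 k) ?(leq_trans mn) //= (@big_cat_nat _ _ _ n m k) //=.
by rewrite addrCA lerDl addr_ge0 // sumr_ge0.
Qed.

(** * Binomial bounds for the coefficients of the gap polynomials *)

Section GapPolyBounds.
Variable R : realType.
Notation P := (gap_poly R).

Lemma coef_gap_polyS d b : (P d)`_b.+1 * b.+1%:R =
  d%:R / 2 * \sum_(j < b.+1) \sum_(1 <= i < d) (P i)`_j * (P (d - i))`_(b - j).
Proof.
rewrite mulr_natr -coef_deriv deriv_gap_poly coefZ coef_sum; congr (_ * _).
rewrite exchange_big /=; apply: eq_bigr => i _; exact: coefM.
Qed.

(** Catalan numbers and binomials convolve separately, the latter to ['C(d - 1, 2 b + 1)]; the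
    factor [d] turns this into [(2 b + 2) 'C(d, 2 b + 2)], and passing from [d] to [d - 1] only
    decreases it. *)
Lemma gap_poly_lower d b : catalan R b * 'C(d.-1, 2 * b)%:R <= (P d)`_b.
Proof.
elim/ltn_ind: b d => -[|b] IHb d.
  by rewrite coef0_gap_poly catalan0 muln0 bin0 mul1r.
have b0 : 0 < b.+1%:R :> R by rewrite ltr0n.
rewrite -(ler_pM2r b0) coef_gap_polyS.
apply: (@le_trans _ _ (d%:R / 2 * (catalan R b.+1 * 'C(d.-1, (2 * b).+1)%:R))).
  have -> : d%:R / 2 * (catalan R b.+1 * 'C(d.-1, (2 * b).+1)%:R) =
      catalan R b.+1 * (d * 'C(d.-1, (2 * b).+1))%:R / 2 by rewrite natrM; field.
  have -> : (d * 'C(d.-1, (2 * b).+1) = 2 * b.+1 * 'C(d, 2 * b.+1))%N.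
    case: d => [|d]; first by rewrite bin0n mul0n muln0.
    by rewrite /= mul_bin_diag mulnS.
  have -> : catalan R b.+1 * (2 * b.+1 * 'C(d, 2 * b.+1))%:R / 2 =
      catalan R b.+1 * 'C(d, 2 * b.+1)%:R * b.+1%:R by rewrite !natrM; field.
  by rewrite ler_wpM2r // ler_wpM2l ?catalan_ge0 // ler_nat leq_bin2l // leq_pred.
apply: ler_wpM2l; first by rewrite divr_ge0.
rewrite -catalan_conv mulr_suml; apply: ler_sum => j _.
have jb : (j <= b)%N by rewrite -ltnS.
apply: (@le_trans _ _ (\sum_(1 <= i < d)
    (catalan R j * 'C(i.-1, 2 * j)%:R) * (catalan R (b - j) * 'C((d - i).-1, 2 * (b - j))%:R))).
  case: d => [|[|d]]; first by rewrite bin0n mulr0 big_geq.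
    by rewrite bin0n mulr0 big_geq.
  rewrite big_add1 /= (_ : (2 * b).+1 = (2 * j + 2 * (b - j)).+1)%N; last lia.
  rewrite -sum_bin_bin natr_sum mulr_sumr; apply: ler_sum_nat => i /andP[_ id].
  rewrite (_ : (d.+2 - i.+1).-1 = d - i)%N; last lia.
  by rewrite natrM le_eqVlt; apply/orP; left; apply/eqP; ring.
apply: ler_sum_nat => i _.
by apply: ler_pM; rewrite ?mulr_ge0 ?catalan_ge0 ?IHb //; lia.
Qed.

Lemma gap_poly_ge0 d b : 0 <= (P d)`_b.
Proof. by apply: le_trans (gap_poly_lower d b); rewrite mulr_ge0 ?catalan_ge0. Qed.

Lemma gap_poly_upper d b : (P d)`_b <= catalan R b * 'C(d + 2 * b, 2 * b)%:R.
Proof.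
elim/ltn_ind: b d => -[|b] IHb d.
  by rewrite coef0_gap_poly catalan0 muln0 bin0 mul1r.
have b0 : 0 < b.+1%:R :> R by rewrite ltr0n.
rewrite -(ler_pM2r b0) coef_gap_polyS.
apply: (@le_trans _ _ (d%:R / 2 * (catalan R b.+1 * 'C((d + 2 * b).+1, (2 * b).+1)%:R))); last first.
  (* Enlarging the factor [d] to [d + 2 b + 2] makes the absorption identity for binomials
     applicable. *)
  apply: (@le_trans _ _ ((d + 2 * b).+2%:R / 2 *
      (catalan R b.+1 * 'C((d + 2 * b).+1, (2 * b).+1)%:R))).
    rewrite ler_wpM2r ?mulr_ge0 ?catalan_ge0 // ler_wpM2r ?invr_ge0 // ler_nat; lia.
  have := mul_bin_diag (d + 2 * b).+2 (2 * b).+1; rewrite /= => e.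
  have -> : (d + 2 * b.+1 = (d + 2 * b).+2)%N by lia.
  have -> : (2 * b.+1 = (2 * b).+2)%N by lia.
  set B := 'C(_, (2 * b).+1) in e *.
  have -> : (d + 2 * b).+2%:R / 2 * (catalan R b.+1 * B%:R) =
      catalan R b.+1 * ((d + 2 * b).+2 * B)%:R / 2 by rewrite natrM; ring.
  have e2 : (2 * b).+2%:R = 2 * b.+1%:R :> R by rewrite -natrM; congr _%:R; lia.
  by rewrite e natrM e2 le_eqVlt; apply/orP; left; apply/eqP; field.
apply: ler_wpM2l; first by rewrite divr_ge0.
rewrite -catalan_conv mulr_suml; apply: ler_sum => j _.
have jb : (j <= b)%N by rewrite -ltnS.
apply: (@le_trans _ _ (\sum_(1 <= i < d)
    (catalan R j * 'C(i + 2 * j, 2 * j)%:R) *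
    (catalan R (b - j) * 'C(d - i + 2 * (b - j), 2 * (b - j))%:R))).
  apply: ler_sum_nat => i _.
  by apply: ler_pM; rewrite ?gap_poly_ge0 ?IHb //; lia.
rewrite (_ : (2 * b).+1 = (2 * j + 2 * (b - j)).+1)%N; last lia.
rewrite -sum_bin_bin natr_sum mulr_sumr.
pose f i := catalan R j * catalan R (b - j) *
  ('C(i, 2 * j)%:R * 'C(d + 2 * b - i, 2 * (b - j))%:R).
have f0 i : 0 <= f i by rewrite /f !mulr_ge0 ?catalan_ge0.
rewrite (_ : \sum_(0 <= i < _) _ = \sum_(0 <= i < (d + 2 * b).+1) f i); last first.
  by apply: eq_big_nat => i _; rewrite natrM.
case: (posnP d) => [d0|d0].
  by rewrite big_geq ?d0 // sumr_ge0.
(* Shifted by [2 j], the indices cover only part of the full binomial convolution, whose terms are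
   nonnegative. *)
apply: le_trans (ler_sum_subrange (m := 1 + 2 * j) (n := d + 2 * j) f0 _ _); [|lia|lia].
rewrite big_addn addnK le_eqVlt; apply/orP; left; apply/eqP.
apply: eq_big_nat => i /andP[_ id]; rewrite /f.
rewrite (_ : d + 2 * b - (i + 2 * j) = d - i + 2 * (b - j))%N; last lia.
ring.
Qed.


End GapPolyBounds.

Lemma bin_le_exp (a q : nat) : ('C(a, q) <= a ^ q)%N.
Proof.
elim: q => [|q IHq]; first by rewrite bin0.
apply: (@leq_trans (q.+1 * 'C(a, q.+1))%N); first by rewrite leq_pmull.
by rewrite mul_bin_left expnS leq_mul // leq_subr.
Qed.

Lemma coef_prod_trunc (R : comNzRingType) (I : Type) (s : seq I) (F G : I -> {poly R}) N :
  (forall i k, (k <= N)%N -> (F i)`_k = (G i)`_k) ->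
  forall k, (k <= N)%N -> (\prod_(i <- s) F i)`_k = (\prod_(i <- s) G i)`_k.
Proof.
move=> FG; elim: s => [|i s IHs] k kN; first by rewrite !big_nil.
rewrite !big_cons !coefM; apply: eq_bigr => j _.
have jk : (j <= k)%N by rewrite -ltnS.
by rewrite FG ?IHs //; lia.
Qed.

(** Coefficients beyond [N] cannot contribute, so each factor may be truncated at degree [N] and the
    exponents range over a finite type. *)
Lemma coef_prod (R : comNzRingType) (m N : nat) (F : 'I_m -> {poly R}) :
  (\prod_(k < m) F k)`_N =
  \sum_(b : {ffun 'I_m -> 'I_N.+1} | (\sum_(k < m) val (b k))%N == N)
    \prod_(k < m) (F k)`_(b k).
Proof.
rewrite (@coef_prod_trunc _ _ _ F (fun i => \sum_(j < N.+1) (F i)`_j *: 'X^j) N) //; last first.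
  move=> i k kN; rewrite -(poly_def N.+1 (fun j => (F i)`_j)) coef_poly ltnS kN //.
rewrite bigA_distr_bigA /= coef_sum [RHS]big_mkcond; apply: eq_bigr => b _.
rewrite scaler_prod coefZ prodrXr coefXn.
by rewrite eq_sym; case: ifP => _; rewrite ?mulr1 ?mulr0.
Qed.

(** * Limits of rescaled binomials and coefficients *)

Section Asymptotics.
Variables (R : realType) (r : nat -> R).
Hypothesis r0 : forall N, 0 <= r N.
Hypothesis cvg_r : r @ \oo --> 0.
Notation P := (gap_poly R).

Lemma cvg_natD (D : nat -> nat) (c : nat) (x : R) :
  (fun N => (D N)%:R * r N) @ \oo --> x ->
  (fun N => (D N + c)%:R * r N) @ \oo --> x.
Proof.
move=> Dx; under eq_fun do rewrite natrD mulrDl.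
rewrite -[x]addr0 -[X in _ + X](mulr0 c%:R); apply: cvgD => //.
exact: cvgMl_tmp.
Qed.

(** The truncated difference removes [minn (D N) c], which is bounded and vanishes after scaling. *)
Lemma cvg_natB (D : nat -> nat) (c : nat) (x : R) :
  (fun N => (D N)%:R * r N) @ \oo --> x ->
  (fun N => (D N - c)%:R * r N) @ \oo --> x.
Proof.
move=> Dx.
have H : (fun N => (minn (D N) c)%:R * r N) @ \oo --> 0.
  apply: (@squeeze_cvgr _ _ _ _ (fun=> 0) (fun N => c%:R * r N)).
  - apply: nearW => N; rewrite mulr_ge0 //= ler_wpM2r // ler_nat geq_minr //.
  - exact: cvg_cst.
  - by rewrite -[X in _ --> X](mulr0 c%:R); apply: cvgMl_tmp.
have -> : (fun N => (D N - c)%:R * r N) =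
    (fun N => (D N)%:R * r N - (minn (D N) c)%:R * r N).
  by apply/funext => N; rewrite -mulrBl -natrB ?geq_minl //; congr (_%:R * _); lia.
by rewrite -[x]subr0; apply: cvgB.
Qed.

Lemma cvg_bin (D : nat -> nat) (x : R) (q : nat) :
  (fun N => (D N)%:R * r N) @ \oo --> x ->
  (fun N => 'C(D N, q)%:R * r N ^+ q) @ \oo --> x ^+ q / q`!%:R.
Proof.
move=> Dx; elim: q => [|q IHq].
  by under eq_fun do rewrite bin0 expr0 mulr1; rewrite expr0 fact0 divr1; exact: cvg_cst.
have q0 : q.+1%:R != 0 :> R by rewrite pnatr_eq0.
have -> : (fun N => 'C(D N, q.+1)%:R * r N ^+ q.+1) =
   (fun N => (q.+1%:R)^-1 * (((D N - q)%:R * r N) * ('C(D N, q)%:R * r N ^+ q))).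
  apply/funext => N; rewrite mulrACA -natrM -mul_bin_left natrM exprS.
  by rewrite -!mulrA mulKf.
have -> : x ^+ q.+1 / q.+1`!%:R = q.+1%:R^-1 * (x * (x ^+ q / q`!%:R)).
  rewrite factS natrM invfM exprS; ring.
apply: cvgMl_tmp; apply: cvgM => //; exact: cvg_natB.
Qed.

(** Both binomial bounds rescale to [x ^ (2 b) / (2 b)!], and the numerator of the Catalan number
    cancels [(2 b)!]. *)
Lemma cvg_gap_poly (D : nat -> nat) (x : R) (b : nat) :
  (fun N => (D N)%:R * r N) @ \oo --> x ->
  (fun N => (P (D N))`_b * r N ^+ (2 * b)) @ \oo --> x ^+ (2 * b) / (b`! * b.+1`!)%:R.
Proof.
move=> Dx.
have -> : x ^+ (2 * b) / (b`! * b.+1`!)%:R = catalan R b * (x ^+ (2 * b) / (2 * b)`!%:R).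
  have n1 : (2 * b)`!%:R != 0 :> R by rewrite pnatr_eq0 -lt0n fact_gt0.
  by rewrite [RHS]mulrC mulrA divfK.
apply: (@squeeze_cvgr _ _ _ _
  (fun N => catalan R b * ('C(D N - 1, 2 * b)%:R * r N ^+ (2 * b)))
  (fun N => catalan R b * ('C(D N + 2 * b, 2 * b)%:R * r N ^+ (2 * b)))).
- apply: nearW => N; rewrite !mulrA !ler_wpM2r ?exprn_ge0 ?gap_poly_upper //.
  by rewrite subn1 gap_poly_lower.
- by apply: cvgMl_tmp; apply: cvg_bin; exact: cvg_natB.
- by apply: cvgMl_tmp; apply: cvg_bin; exact: cvg_natD.
Qed.

End Asymptotics.

(** Uniformity in [d] is what domination requires; it rests on [d + 2 b <= (2 b + 1) n]. *)
Lemma gap_poly_le_exp (R : realType) (d n b : nat) : (d <= n)%N -> (0 < n)%N ->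
  (gap_poly R d)`_b <= catalan R b * (2 * b).+1%:R ^+ (2 * b) * n%:R ^+ (2 * b).
Proof.
move=> dn n0; apply: le_trans (gap_poly_upper _ _ _) _.
rewrite -mulrA ler_wpM2l ?catalan_ge0 // -exprMn -natrM -natrX ler_nat.
apply: leq_trans (bin_le_exp _ _) _; case: b => [|b] //.
rewrite leq_exp2r //; nia.
Qed.

(** * Riemann sums for iterated integrals *)

Section Riemann.
Variable R : realType.
Notation mu := (@lebesgue_measure R).

(** There are [N + 1] cells of width [1 / N] per coordinate, matching the indices 0 to [N], so the
    grid reaches slightly beyond 1. *)
Definition in_grid (N : nat) (x : R) : bool := (0 <= x) && (Num.truncn (N%:R * x) <= N)%N.

Definition cell_fun (N : nat) (f : seq nat -> R) (s : seq R) : R :=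
  if all (in_grid N) s then f [seq Num.truncn (N%:R * x) | x <- s] else 0.

Definition riemann_sum (k N : nat) (f : seq nat -> R) : R :=
  N%:R ^- k * \sum_(a : k.-tuple 'I_N.+1) f (map val a).

Lemma riemann_sum0 N f : riemann_sum 0 N f = f [::].
Proof.
rewrite /riemann_sum expr0 invr1 mul1r (big_pred1 [tuple]) //.
by move=> w; apply/esym/eqP; exact: tuple0.
Qed.

Lemma riemann_sumS k N f : riemann_sum k.+1 N f =
  N%:R^-1 * \sum_(i < N.+1) riemann_sum k N (fun a => f (val i :: a)).
Proof.
rewrite /riemann_sum (sum_tuple_cons (fun a : seq 'I_N.+1 => f (map val a))).
by rewrite exprS invfM -mulrA -mulr_sumr.
Qed.

Lemma cell_fun_cons N f x s : cell_fun N f (x :: s) =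
  cell_fun N (fun a => if in_grid N x then f (Num.truncn (N%:R * x) :: a) else 0) s.
Proof. by rewrite /cell_fun /=; case: (in_grid N x) => //=; rewrite if_same. Qed.

(** Each coordinate costs a factor [(N + 1) / N <= 2]; for [N = 0] the inverse is 0. *)
Lemma riemann_sum_bound k N f K : 0 <= K -> (forall a, size a = k -> `|f a| <= K) ->
  `|riemann_sum k N f| <= K * 2 ^+ k.
Proof.
move=> K0; elim: k f => [|k IHk] f fK; first by rewrite riemann_sum0 mulr1 fK.
rewrite riemann_sumS normrM normfV normr_nat.
have [->|N0] := posnP N.
  by rewrite invr0 mul0r mulr_ge0 // exprn_ge0.
have N0' : 0 < N%:R :> R by rewrite ltr0n.
rewrite ler_pdivrMl //; apply: le_trans (ler_norm_sum _ _ _) _.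
apply: (@le_trans _ _ (\sum_(i < N.+1) K * 2 ^+ k)).
  by apply: ler_sum => i _; apply: IHk => a ak; apply: fK; rewrite /= ak.
rewrite sumr_const card_ord -[leLHS]mulr_natl exprS.
rewrite [leRHS](_ : _ = N%:R * 2 * (K * 2 ^+ k)); last by ring.
rewrite ler_wpM2r ?mulr_ge0 ?exprn_ge0 // -natrM ler_nat; lia.
Qed.

Definition cell (N i : nat) : set R := `[i%:R / N%:R, i.+1%:R / N%:R[%classic.

Lemma cell_sumE (N : nat) (f : nat -> R) (x : R) : (0 < N)%N ->
  (if in_grid N x then f (Num.truncn (N%:R * x)) else 0) =
  \sum_(i < N.+1) f i * \1_(cell N i) x.
Proof.
move=> N0; have N0' : 0 < N%:R :> R by rewrite ltr0n.
have memE i : (x \in cell N i) = (0 <= x) && (Num.truncn (N%:R * x) == i).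
  apply/idP/idP => [|/andP[x0 /eqP <-]].
    rewrite inE /cell /= in_itv /= ler_pdivrMr // ltr_pdivlMr // [x * _]mulrC => /andP[h1 h2].
    rewrite (truncn_def (n := i)) ?h1 ?h2 // eqxx andbT.
    by rewrite -(pmulr_rge0 _ N0') (le_trans _ h1).
  rewrite inE /cell /= in_itv /= ler_pdivrMr // ltr_pdivlMr // [x * _]mulrC.
  by apply: truncn_itv; rewrite mulr_ge0.
have [x0|x0] := boolP (0 <= x); last first.
  by rewrite /in_grid (negbTE x0) /= big1 // => i _; rewrite indicE memE (negbTE x0) mulr0.
rewrite /in_grid x0 /=; case: ltnP => [lt|ge]; last first.
  have lt : (Num.truncn (N%:R * x) < N.+1)%N by [].
  rewrite (bigD1 (Ordinal lt)) //= indicE memE x0 eqxx mulr1 big1 ?addr0 // => i ine.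
  rewrite indicE memE x0 /= eq_sym; case: eqP => [E|]; last by rewrite mulr0.
  by case/eqP: ine; apply: val_inj.
rewrite big1 // => i _; rewrite indicE memE x0 /=.
case: eqP => [E|]; last by rewrite mulr0.
by have := ltn_ord i; rewrite -E; lia.
Qed.

Lemma measurable_cell N i : measurable (cell N i).
Proof. exact: measurable_itv. Qed.

Lemma measurable_cell_sum (N : nat) (f : nat -> R) :
  measurable_fun setT (fun x => \sum_(i < N.+1) f i * \1_(cell N i) x).
Proof.
apply: measurable_sum => i; apply: measurable_funM => //.
apply: measurable_indic; exact: measurable_cell.
Qed.

Lemma integral_cell_sum (N : nat) (f : nat -> R) : (0 < N)%N ->
  (\int[mu]_x (\sum_(i < N.+1) f i * \1_(cell N i) x)%:E = (N%:R^-1 * \sum_(i < N.+1) f i)%:E)%E.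
Proof.
move=> N0; have N0' : 0 < N%:R :> R by rewrite ltr0n.
have int1 i : mu.-integrable setT (fun x => (\1_(cell N i) x)%:E).
  exact: integrable_indic_itv.
under eq_integral do rewrite -sumEFin.
rewrite integral_sum //; last first.
  move=> i; under eq_fun do rewrite EFinM; exact: integrableZl.
rewrite mulr_sumr -sumEFin; apply: eq_bigr => i _.
under eq_integral do rewrite EFinM.
rewrite integralZl // integral_indic //; last exact: measurable_cell.
rewrite setIT /= lebesgue_measure_itv /= lte_fin.
rewrite ltr_pM2r ?invr_gt0 // ltr_nat ltnSn -EFinB -EFinM; congr (_%:E).
by rewrite -mulrBl -natrB // subSnn mul1r mulrC.
Qed.

(** Induction on the dimension: the inner sums are the heights of a step function of the first
    variable, they converge pointwise by the induction hypothesis, and dominated convergence handles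
    the outer integral. *)
Lemma riemann_sum_cvg (k : nat) (f : nat -> seq nat -> R) (F : seq R -> R) (K : R) :
  0 <= K -> (forall N a, size a = k -> `|f N a| <= K) ->
  (forall s, size s = k -> (fun N => cell_fun N (f N) s) @ \oo --> F s) ->
  (fun N => riemann_sum k N (f N)) @ \oo --> iter_integral k F.
Proof.
move=> K0; elim: k f F => [|k IHk] f F fK fF.
  under eq_fun do rewrite riemann_sum0.
  exact: fF.
pose r N i := riemann_sum k N (fun a => f N (i :: a)).
pose J x := iter_integral k (fun s => F (x :: s)).
pose h N x := if in_grid N x then r N (Num.truncn (N%:R * x)) else 0.
have hJ x : (fun N => h N x) @ \oo --> J x.
  have -> : (fun N => h N x) = (fun N => riemann_sum k N
      (fun a => if in_grid N x then f N (Num.truncn (N%:R * x) :: a) else 0)).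
    apply/funext => N; rewrite /h; case: (in_grid N x) => //.
    by rewrite /riemann_sum big1 ?mulr0.
  apply: IHk.
    move=> N a ak; case: (in_grid N x); last by rewrite normr0.
    by apply: fK; rewrite /= ak.
  move=> s sk; have := fF (x :: s); rewrite /= sk => /(_ erefl).
  by under eq_fun do rewrite cell_fun_cons.
rewrite -cvg_shiftS /=.
pose h' N x := \sum_(i < N.+2) r N.+1 i * \1_(cell N.+1 i) x.
have hE N x : h N.+1 x = h' N x by rewrite /h (cell_sumE _ x (ltn0Sn N)).
have mh N : measurable_fun setT (h' N) by exact: measurable_cell_sum.
have h'J x : (fun N => h' N x) @ \oo --> J x.
  have := hJ x; rewrite -(cvg_shiftS (fun N => h N x)) /=.
  by under eq_fun do rewrite hE.
(* The partial integral is measurable as a pointwise limit of step functions. *)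
have mJ : measurable_fun setT J by apply: (measurable_fun_cvg mh) => x _; exact: h'J.
(* For mesh [1 / (N + 1)] the cells end at [1 + 1 / (N + 1)], hence inside the interval from 0 to
   2. *)
pose B x := K * 2 ^+ k * \1_(`[0, 2]%classic : set R) x.
have iB : mu.-integrable setT (EFin \o B).
  rewrite (_ : _ \o _ = fun x => (K * 2 ^+ k)%:E * (\1_(`[0, 2]%classic : set R) x)%:E)%E.
    by apply: integrableZl => //; exact: integrable_indic_itv.
  by apply/funext => x; rewrite /B /= EFinM.
have bnd N x : (`|(h' N x)%:E| <= (EFin \o B) x)%E.
  rewrite /= lee_fin -hE /h /B; case: ifP => [/andP[x0 xN]|_]; last first.
    by rewrite normr0 !mulr_ge0 // exprn_ge0.
  rewrite indicE mem_set ?mulr1.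
    by apply: riemann_sum_bound => // a ak; apply: fK; rewrite /= ak.
  rewrite /= in_itv /= x0 /=; move: xN; rewrite truncn_le_nat => xN.
  have N1 : 1 <= N.+1%:R :> R by rewrite ler1n.
  by move: xN; rewrite -[N.+2]addn1 natrD => xN; nra.
have [] := @dominated_convergence _ _ _ mu setT measurableT
  (fun N => EFin \o h' N) (EFin \o J) (EFin \o B).
- by move=> N; apply/measurable_EFinP; exact: mh.
- by apply/measurable_EFinP; exact: mJ.
- by apply: aeW => x _; apply: cvg_EFin; [exact: nearW|exact: h'J].
- exact: iB.
- by apply: aeW => x N _; exact: bnd.
move=> iJ _ cvJ.
have Jfin : (\int[mu]_x (EFin \o J) x)%E \is a fin_num by exact: integrable_fin_num.
have -> : (fun N => riemann_sum k.+1 N.+1 (f N.+1)) =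
    fine \o (fun N => \int[mu]_x (EFin \o h' N) x)%E.
  by apply/funext => N; rewrite /= integral_cell_sum // riemann_sumS.
have H : fine \o (fun N => \int[mu]_x (EFin \o h' N) x)%E @ \oo -->
    fine (\int[mu]_x (EFin \o J) x)%E by apply: fine_cvg; rewrite fineK.
exact: H.
Qed.

End Riemann.

(** * Convergence of the expectations *)

Lemma cvg_rowmx (R : realType) (m : nat) (u : nat -> 'I_m -> R) (l : 'I_m -> R) :
  (forall i, (fun N => u N i) @ \oo --> l i) ->
  (fun N => \row_i u N i) @ \oo --> \row_i l i.
Proof.
move=> ul A [P nP sPA].
have H : \forall N \near \oo, forall j, P ord0 j (u N j).
  apply: filter_forall => j; apply: (ul j).
  by have := nP ord0 j; rewrite mxE.
by apply: filterS H => N HN; apply: sPA => i j; rewrite mxE ord1.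
Qed.

Lemma prod_list_nth (R : comNzRingType) (c : seq nat) (m : nat) (f : nat -> R) :
  size c = m -> \prod_(d <- c) f d = \prod_(i < m) f (nth 0%N c i).
Proof. by move=> <-; rewrite (big_nth 0%N) big_mkord. Qed.

Section Scale.
Variables (R : realType) (k : nat).

(** The cycle has [n = N + k + 1] sites: [k + 1] holes remain and their gaps sum to [N]. Gaps are
    thus divided by [n], while the grid has mesh [1 / N]. *)
Definition scale (N : nat) : R := (N + k.+1)%:R^-1.

Lemma scale_ge0 N : 0 <= scale N.
Proof. by rewrite invr_ge0. Qed.

Lemma cvg_scale : scale @ \oo --> (0 : R).
Proof.
have H : (fun N => @harmonic R (N + k)%N) @ \oo --> 0.
  by rewrite (@cvg_shiftn k _ (@harmonic R)); exact: cvg_harmonic.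
rewrite (_ : scale = fun N => @harmonic R (N + k)%N) //.
by apply/funext => N; rewrite /scale /harmonic /= addnS.
Qed.

Lemma cvg_scaled : (fun N => N%:R * scale N) @ \oo --> (1 : R).
Proof.
have -> : (fun N => N%:R * scale N) = (fun N => 1 - k.+1%:R * scale N).
  apply/funext => N; have n0 : (N + k.+1)%:R != 0 :> R by rewrite pnatr_eq0 addnS.
  apply: (mulIf n0); rewrite mulrBl -!mulrA mulVf // !mulr1 mul1r natrD; ring.
rewrite -[X in _ --> X]subr0 -[X in _ - X](mulr0 k.+1%:R).
by apply: cvgB; [exact: cvg_cst|apply: cvgMl_tmp; exact: cvg_scale].
Qed.

Lemma scaled_le1 N : N%:R * scale N <= 1.
Proof. by rewrite /scale ler_pdivrMr ?mul1r ?ler_nat ?leq_addr // ltr0n addnS. Qed.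

Lemma cvg_scaled_n : (fun N => (N + k.+1)%:R * scale N) @ \oo --> (1 : R).
Proof. by apply: cvg_natD; [exact: cvg_scale|exact: cvg_scaled]. Qed.

Lemma cvg_trunc (x : R) : 0 <= x ->
  (fun N => (Num.truncn (N%:R * x))%:R * scale N) @ \oo --> x.
Proof.
move=> x0.
have Hx : (fun N => N%:R * scale N * x) @ \oo --> x.
  by rewrite -[X in _ --> X]mul1r; apply: cvgMr_tmp; exact: cvg_scaled.
apply: (@squeeze_cvgr _ _ _ _ (fun N => N%:R * scale N * x - scale N)
   (fun N => N%:R * scale N * x)) => //.
- apply: nearW => N; have s0 := scale_ge0 N.
  have Nx : 0 <= N%:R * x by rewrite mulr_ge0.
  have /andP[h1 h2] := truncn_itv Nx.
  rewrite mulrAC; apply/andP; split; last by rewrite ler_wpM2r.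
  by rewrite -[X in _ - X]mul1r -mulrBl ler_wpM2r // lerBlDr natr1 ltW.
- by rewrite -[X in _ --> X]subr0; apply: cvgB => //; exact: cvg_scale.
Qed.

(** ['C(n, Nh)] grows like [n ^ Nh / Nh!]; this is where the factor [Nh!] of the density comes
    from. *)
Lemma cvg_binV (Nh : nat) :
  (fun N => ('C(N + k.+1, Nh)%:R * scale N ^+ Nh)^-1) @ \oo --> (Nh`!%:R : R).
Proof.
have := @cvg_bin R scale scale_ge0 cvg_scale (fun N => N + k.+1)%N 1 Nh cvg_scaled_n.
rewrite expr1n mul1r => H; rewrite -[X in _ --> X]invrK; apply: cvgV => //.
Qed.

(** When positive binomials make it meaningful, the ratio is the probability that uniformly dropped
    balls land on distinct sites off the holes. *)
Lemma cvg_ffact_ratio (Nb Nh : nat) :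
  (fun N => (('C(N + k.+1, Nh) * (N + k.+1 - Nh) ^_ Nb)%N)%:R /
            (('C(N + k.+1, Nh) * (N + k.+1) ^ Nb)%N)%:R) @ \oo --> (1 : R).
Proof.
have nB : (fun N => (N + k.+1 - Nh)%:R * scale N) @ \oo --> (1 : R).
  by apply: cvg_natB; [exact: scale_ge0|exact: cvg_scale|exact: cvg_scaled_n].
have := @cvg_bin R scale scale_ge0 cvg_scale (fun N => N + k.+1 - Nh)%N 1 Nb nB.
rewrite expr1n mul1r => H.
have H2 : (fun N => Nb`!%:R * ('C(N + k.+1 - Nh, Nb)%:R * scale N ^+ Nb)) @ \oo --> (1 : R).
  have nf : Nb`!%:R != 0 :> R by rewrite pnatr_eq0 -lt0n fact_gt0.
  by rewrite -[X in _ --> X](divff nf); apply: cvgMl_tmp.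
apply: cvg_trans H2; apply: near_eq_cvg; near=> N.
have NN : (Nh <= N)%N by near: N; exact: nbhs_infty_ge.
have C0 : 'C(N + k.+1, Nh)%:R != 0 :> R.
  by rewrite pnatr_eq0 -lt0n bin_gt0 (leq_trans NN) // leq_addr.
rewrite -bin_ffact !natrM natrX /scale exprVn.
have n0 : (N + k.+1)%:R ^+ Nb != 0 :> R by rewrite expf_neq0 // pnatr_eq0 addnS.
by field; rewrite n0.
Unshelve. all: by end_near. Qed.

End Scale.

Section GridTerm.
Variables (R : realType) (Nb Nh k : nat).
Hypothesis NhE : (Nh - Nb = k.+1)%N.
Variables (g : 'rV[R]_(Nh - Nb) -> R) (M : R).
Hypothesis g_cont : continuous g.
Hypothesis gM : forall v, `|g v| <= M.

Definition gaps_row (n : nat) (c : seq nat) : 'rV[R]_(Nh - Nb) :=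
  \row_i ((nth 0%N c i)%:R / n%:R).

(** Coefficient [Nb] of the product of gap polynomials, expanded over exponents and scaled by
    [s ^+ (2 * Nb)]; the successor turns a gap into a distance. *)
Definition weight_sum (s : R) (c : seq nat) : R :=
  \sum_(b : {ffun 'I_(Nh - Nb) -> 'I_Nb.+1} | (\sum_(i < Nh - Nb) val (b i))%N == Nb)
    \prod_(i < Nh - Nb) ((gap_poly R (nth 0%N c i).+1)`_(b i) * s ^+ (2 * b i)).

(* Normalised by powers of 1 / n so that each factor converges separately. *)
Definition grid_term (N : nat) (a : seq nat) : R :=
  let c := close_gaps N a in let s := scale R k N in
  if (sumn a <= N)%N then
    (N%:R * s) ^+ k * ((nth 0%N c 0).+1%:R * s) * ('C(N + k.+1, Nh)%:R * s ^+ Nh)^-1 *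
    Nb`!%:R * weight_sum s c * g (gaps_row (N + k.+1) c)
  else 0.

Lemma grid_term_bound : exists2 K : R, 0 <= K &
  forall N a, size a = k -> `|grid_term N a| <= K.
Proof.
(* A convergent sequence is bounded; for small [N] the binomial may be 0, and then its inverse is 0
   too. *)
have [B B0 HB] : exists2 B : R, 0 <= B &
    forall N, `|('C(N + k.+1, Nh)%:R * scale R k N ^+ Nh)^-1| <= B.
  have /cvgP/cvg_seq_bounded [B [_ /(_ (`|B| + 1))]] := @cvg_binV R k Nh.
  rewrite (le_lt_trans (ler_norm B)) ?ltrDl // => /(_ isT) H.
  by exists (`|B| + 1); [rewrite addr_ge0|move=> N; exact: (H N)].
pose Kc (b : nat) : R := catalan R b * (2 * b).+1%:R ^+ (2 * b).
have Kc0 b : 0 <= Kc b by rewrite mulr_ge0 ?catalan_ge0 ?exprn_ge0.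
pose W : R := \sum_(b : {ffun 'I_(Nh - Nb) -> 'I_Nb.+1} |
    (\sum_(i < Nh - Nb) val (b i))%N == Nb) \prod_(i < Nh - Nb) Kc (b i).
have W0 : 0 <= W by apply: sumr_ge0 => b _; apply: prodr_ge0.
have M0 : 0 <= M by apply: le_trans (gM 0).
exists (1 * 1 * B * Nb`!%:R * W * M); first by rewrite !mulr_ge0.
move=> N a ak; rewrite /grid_term; case: ifP => aN; last by rewrite normr0 !mulr_ge0.
set c := close_gaps N a; set s := scale R k N.
have s0 : 0 <= s := scale_ge0 R k N.
have n0 : 0 < (N + k.+1)%:R :> R by rewrite ltr0n addnS.
have cb i : ((nth 0%N c i).+1 <= N + k.+1)%N.
  have := nth_le_sumn c i; rewrite (sumn_close_gaps aN); lia.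
rewrite !normrM; do 5?[apply: ler_pM; rewrite ?mulr_ge0 //].
- by rewrite normrX ger0_norm ?mulr_ge0 // exprn_ile1 ?mulr_ge0 ?scaled_le1.
- rewrite -normrM ger0_norm ?mulr_ge0 // /s /scale ler_pdivrMr // mul1r ler_nat.
  exact: cb.
- by rewrite ger0_norm.
- apply: le_trans (ler_norm_sum _ _ _) _; apply: ler_sum => b _.
  rewrite normr_prod; apply: ler_prod => i _; rewrite normr_ge0 /=.
  rewrite ger0_norm ?mulr_ge0 ?gap_poly_ge0 ?exprn_ge0 //.
  have := gap_poly_le_exp R (b i) (cb i) ltac:(lia).
  rewrite -/(Kc _) => H.
  rewrite /s /scale exprVn ler_pdivrMr ?exprn_gt0 //.
Qed.

Lemma le_sum_all (s : seq R) x : all (fun y => 0 <= y) s -> x \in s -> x <= \sum_(y <- s) y.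
Proof.
elim: s => //= z s IHs /andP[z0 s0]; rewrite inE big_cons => /orP[/eqP ->|xs].
  by rewrite lerDl big_seq sumr_ge0 // => y ys; exact: (allP s0).
by rewrite (le_trans (IHs s0 xs)) // lerDr.
Qed.

Local Notation tr N s := [seq Num.truncn (N%:R * x) | x <- s].

Lemma sumn_trunc_le N (s : seq R) : all (fun y => 0 <= y) s ->
  (sumn (tr N s))%:R <= N%:R * \sum_(y <- s) y.
Proof.
elim: s => [|x s IHs] /=; first by rewrite big_nil mulr0.
move=> /andP[x0 s0]; rewrite big_cons natrD mulrDr lerD ?IHs //.
by rewrite truncn_le mulr_ge0.
Qed.

Lemma sumn_trunc_ge N (s : seq R) :
  N%:R * (\sum_(y <- s) y) <= (sumn (tr N s) + size s)%:R.
Proof.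
elim: s => [|x s IHs] /=; first by rewrite big_nil mulr0.
rewrite big_cons mulrDr.
rewrite (_ : Num.truncn (N%:R * x) + sumn (tr N s) + (size s).+1 =
  (Num.truncn (N%:R * x)).+1 + (sumn (tr N s) + size s))%N; last lia.
by rewrite natrD lerD // ltW // truncnS_gt.
Qed.

Lemma cvg_sumn_trunc (s : seq R) : all (fun y => 0 <= y) s ->
  (fun N => (sumn (tr N s))%:R * scale R k N) @ \oo --> \sum_(y <- s) y.
Proof.
elim: s => [|x s IHs] /=.
  by rewrite big_nil; under eq_fun do rewrite mul0r; move=> _; exact: cvg_cst.
move=> /andP[x0 s0]; rewrite big_cons; under eq_fun do rewrite natrD mulrDl.
by apply: cvgD; [exact: cvg_trunc|exact: IHs].
Qed.

Lemma cvg_close_gaps (s : seq R) i : size s = k -> all (fun y => 0 <= y) s ->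
  \sum_(y <- s) y <= 1 -> (i <= k)%N ->
  (fun N => (nth 0%N (close_gaps N (tr N s)) i)%:R * scale R k N) @ \oo -->
    nth 0 (complete_simplex s) i.
Proof.
move=> sk s0 s1 ik; rewrite /complete_simplex nth_rcons sk.
have trk N : size (tr N s) = k by rewrite size_map.
case: ltnP => [lt|ge].
  have -> : (fun N => (nth 0%N (close_gaps N (tr N s)) i)%:R * scale R k N) =
      (fun N => (Num.truncn (N%:R * nth 0 s i))%:R * scale R k N).
    apply/funext => N; rewrite /close_gaps nth_rcons trk lt (nth_map 0) ?sk //.
  by apply: cvg_trunc; apply: (allP s0); rewrite mem_nth ?sk.
have -> : i = k by apply/eqP; rewrite eqn_leq ik ge.
rewrite eqxx.
have -> : (fun N => (nth 0%N (close_gaps N (tr N s)) k)%:R * scale R k N) =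
    (fun N => N%:R * scale R k N - (sumn (tr N s))%:R * scale R k N).
  (* The subtraction is not truncated: rounding down keeps the sum of the free gaps at most [N]. *)
  apply/funext => N; rewrite /close_gaps nth_rcons trk ltnn eqxx natrB ?mulrBl //.
  rewrite -(ler_nat R); apply: le_trans (sumn_trunc_le N s0) _.
  by rewrite -[leRHS]mulr1 ler_wpM2l.
by apply: cvgB; [exact: cvg_scaled|exact: cvg_sumn_trunc].
Qed.

(** Inside the simplex the factors converge one by one; outside, the terms vanish, at once for a
    negative coordinate and eventually for a sum above 1. *)
Lemma cell_fun_grid (s : seq R) : size s = k ->
  (fun N => cell_fun N (grid_term N) s) @ \oo -->
  g (\row_(i < Nh - Nb) nth 0 (complete_simplex s) i) * golf_density Nb Nh s.
Proof.
move=> sk; rewrite /golf_density.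
set xs := complete_simplex s.
have szx : size xs = (Nh - Nb)%N by rewrite /xs /complete_simplex size_rcons sk NhE.
have sumx : \sum_(y <- xs) y = 1.
  by rewrite /xs /complete_simplex -cats1 big_cat big_seq1 /= addrC subrK.
have inE' : in_simplex (Nh - Nb) xs = all (fun y => 0 <= y) s && (\sum_(y <- s) y <= 1).
  by rewrite /in_simplex szx sumx !eqxx /= /xs /complete_simplex all_rcons subr_ge0 andbC.
rewrite inE'; case: (boolP (all _ s)) => [s0|sN]; last first.
  rewrite /= !mulr0.
  have -> : (fun N => cell_fun N (grid_term N) s) = (fun=> 0).
    apply/funext => N; rewrite /cell_fun ifF //; apply/negbTE.
    apply: contraNN sN => /allP H; apply/allP => x /H; by case/andP.
  exact: cvg_cst.
case: (leP (\sum_(y <- s) y) 1) => s1; last first.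
  rewrite /= !mulr0.
  have H0 : (fun=> 0 : R) @ \oo --> (0 : R) by exact: cvg_cst.
  apply: cvg_trans H0; apply: near_eq_cvg; near=> N.
  rewrite /cell_fun /grid_term; case: ifP => // _; rewrite ifF //.
  apply/negbTE; rewrite -ltnNge -(ltr_nat R).
  have := sumn_trunc_ge N s; rewrite sk natrD.
  (* Rounding down [k] coordinates loses at most [k], so beyond this threshold the rounded sum still
     exceeds [N]. *)
  have : k%:R / (\sum_(y <- s) y - 1) < N%:R.
    by near: N; exact: nbhs_infty_gtr.
  rewrite ltr_pdivrMr ?subr_gt0 //; lra.
rewrite /= mulr1.
have -> : (fun N => cell_fun N (grid_term N) s) = (fun N =>
   (N%:R * scale R k N) ^+ k * ((nth 0%N (close_gaps N (tr N s)) 0).+1%:R * scale R k N) *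
   ('C(N + k.+1, Nh)%:R * scale R k N ^+ Nh)^-1 *
    Nb`!%:R * weight_sum (scale R k N) (close_gaps N (tr N s)) *
    g (gaps_row (N + k.+1) (close_gaps N (tr N s)))).
  apply/funext => N; rewrite /cell_fun ifT; last first.
    apply/allP => x xs'; have x0 := allP s0 _ xs'; rewrite /in_grid x0 truncn_le_nat.
    have x1 : x <= 1 := le_trans (le_sum_all s0 xs') s1.
    have Nx : N%:R * x <= N%:R * 1 by rewrite ler_wpM2l.
    by rewrite -natr1; lra.
  rewrite /grid_term ifT // -(ler_nat R); apply: le_trans (sumn_trunc_le N s0) _.
  by rewrite -[leRHS]mulr1 ler_wpM2l.
have cc i (ik : (i <= k)%N) := cvg_close_gaps sk s0 s1 ik.
have ccS i : (i <= k)%N -> (fun N => (nth 0%N (close_gaps N (tr N s)) i).+1%:R * scale R k N)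
    @ \oo --> nth 0 xs i.
  move=> ik; under eq_fun do rewrite -addn1.
  by apply: cvg_natD; [exact: cvg_scale|exact: cc].
rewrite [X in _ --> X](_ : _ = 1 ^+ k * nth 0 xs 0 * Nh`!%:R * Nb`!%:R *
   (\sum_(b : {ffun 'I_(Nh - Nb) -> 'I_Nb.+1} | (\sum_(i < Nh - Nb) val (b i))%N == Nb)
     \prod_(i < Nh - Nb) (nth 0 xs i ^+ (2 * b i) / ((b i)`! * (b i).+1`!)%:R)) *
   g (\row_(i < Nh - Nb) nth 0 xs i)); last by rewrite expr1n; ring.
apply: cvgM; last first.
  apply: (@continuous_cvg _ _ _ _ _ _ g); first exact: g_cont.
  apply: cvg_rowmx => i; apply: cc; by have := ltn_ord i; rewrite {2}NhE.
apply: cvgM; last first.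
  apply: cvg_bigsum => b _; apply: cvg_bigprod => i _.
  apply: cvg_gap_poly; [exact: scale_ge0|exact: cvg_scale|apply: ccS].
  by have := ltn_ord i; rewrite {2}NhE.
apply: cvgMr_tmp; apply: cvgM; last exact: cvg_binV.
apply: cvgM; last exact: ccS.
have -> : (fun N => (N%:R * scale R k N) ^+ k) =
    (fun N => \prod_(i < k) (N%:R * scale R k N)).
  by apply/funext => N; rewrite prodr_const card_ord.
have -> : 1 ^+ k = \prod_(i < k) (1 : R) by rewrite prodr_const card_ord.
by apply: cvg_bigprod => i _; exact: cvg_scaled.
Unshelve. all: by end_near. Qed.

End GridTerm.

(** * Comparison of the golf process with the relaxed model *)

Section DropExpectation.
Variables (R : realType) (p : R).
Hypothesis p01 : 0 <= p <= 1.
Variables (Nb Nh k : nat).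
Hypothesis NhE : (Nh - Nb = k.+1)%N.
Variables (g : 'rV[R]_(Nh - Nb) -> R) (M : R).
Hypothesis gM : forall v, `|g v| <= M.

Definition run_expect (n : nat) (q : Nb.-tuple 'I_n * {set 'I_n}) : R :=
  \sum_(S : {set 'I_n}) chain (hit p) q.2 q.1 S * g (gap_vec R (Nh - Nb) S).

Definition drop_expect (n : nat) : R :=
  (#|@any_start n Nb Nh|%:R)^-1 * \sum_(q | @any_start n Nb Nh q) run_expect q.

Lemma run_expect_le n (q : Nb.-tuple 'I_n * {set 'I_n}) : `|run_expect q| <= M.
Proof.
have M0 : 0 <= M by apply: le_trans (gM 0).
have h0 (O : {set 'I_n}) x h : 0 <= hit p O x h by exact: hit_ge0.
apply: le_trans (ler_norm_sum _ _ _) _.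
apply: (@le_trans _ _ (\sum_(S : {set 'I_n}) chain (hit p) q.2 q.1 S * M)).
  apply: ler_sum => S _; rewrite normrM ger0_norm ?chain_ge0 // ler_wpM2l //.
  by rewrite chain_ge0.
rewrite -mulr_suml -[leRHS]mul1r ler_wpM2r // sum_chain_le1 // => O x.
exact: sum_hit_le1.
Qed.

Lemma golf_expectE n : golf_expect n Nb Nh p g =
  (#|@valid_start n Nb Nh|%:R)^-1 * \sum_(q | @valid_start n Nb Nh q) run_expect q.
Proof.
rewrite /golf_expect; under eq_bigr => S _ do rewrite (golf_probE p01) -mulrA mulr_suml.
rewrite -mulr_sumr cardsE; congr (_ * _); rewrite exchange_big /=.
by apply: eq_bigr => q _.
Qed.

Lemma golf_drop_dist n : (0 < #|@valid_start n Nb Nh|)%N ->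
  `|golf_expect n Nb Nh p g - drop_expect n| <=
  2 * M * (1 - (('C(n, Nh) * (n - Nh) ^_ Nb)%N)%:R / (('C(n, Nh) * n ^ Nb)%N)%:R).
Proof.
move=> V0; rewrite golf_expectE /drop_expect -card_valid_start -card_any_start !cardsE.
by apply: average_subset => // [q|q]; [exact: valid_any|exact: run_expect_le].
Qed.

Lemma gap_vec_gaps_row n (S : {set 'I_n}) : #|S| = k.+1 ->
  gap_vec R (Nh - Nb) S = gaps_row R Nb Nh n (list_gaps n (positions S)).
Proof.
move=> Sk; apply/rowP => i; rewrite !mxE gap_nth // Sk.
by have := ltn_ord i; rewrite {2}NhE.
Qed.

(** An exact identity: the mass of a set depends on its gaps only, so the sum over sets becomes a
    sum over gap vectors, and the normalising powers cancel. *)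
Lemma drop_expectE N : (0 < N)%N ->
  drop_expect (N + k.+1) = riemann_sum k N (grid_term k g N).
Proof.
move=> N0; set n := (N + k.+1)%N; set s := scale R k N.
have nn0 : n%:R != 0 :> R by rewrite pnatr_eq0 /n addnS.
have NN0 : N%:R != 0 :> R by rewrite pnatr_eq0 -lt0n.
have s0 : s != 0 by rewrite invr_eq0.
pose Fn (c : seq nat) : R :=
  Nb`!%:R * (\prod_(d <- c) gap_poly R d.+1)`_Nb * g (gaps_row R Nb Nh n c).
have E1 : \sum_(q | @any_start n Nb Nh q) run_expect q =
    \sum_(S : {set 'I_n}) drop_mass p Nb Nh S * g (gap_vec R (Nh - Nb) S).
  rewrite exchange_big /=; apply: eq_bigr => S _; rewrite -mulr_suml; congr (_ * _).
  by rewrite /drop_mass pair_big_dep.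
have E2 : \sum_(S : {set 'I_n}) drop_mass p Nb Nh S * g (gap_vec R (Nh - Nb) S) =
    \sum_(S : {set 'I_n} | #|S| == k.+1) Fn (list_gaps n (positions S)).
  rewrite [RHS]big_mkcond; apply: eq_bigr => S _; case: eqP => [Sk|Sk].
    rewrite (drop_massE p01); first last.
    - by rewrite Sk -NhE subnK //; lia.
    - by rewrite -card_gt0 Sk.
    rewrite gap_vec_gaps_row // /Fn /gap_prod.
    by rewrite (prod_next_dist S (fun d => gap_poly R d)).
  have [->|/drop_mass_card H] := eqVneq (drop_mass p Nb Nh S) 0; first by rewrite mul0r.
  by case: Sk; rewrite -NhE -H addnK.
rewrite /drop_expect E1 E2 (@sum_sets_gaps n N k erefl) /riemann_sum.
rewrite big_mkcond !mulr_sumr; apply: eq_bigr => a _; rewrite /grid_term.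
case: ifP => aN; last by rewrite !mulr0.
have szc : size (close_gaps N (map val a)) = (Nh - Nb)%N.
  by rewrite size_close_gaps size_map size_tuple NhE.
move: szc; set c := close_gaps _ _ => szc.
have -> : weight_sum Nb Nh s c = s ^+ (2 * Nb) * (\prod_(d <- c) gap_poly R d.+1)`_Nb.
  rewrite (prod_list_nth (fun d => gap_poly R d.+1) szc) coef_prod mulr_sumr /weight_sum.
  apply: eq_bigr => b /eqP bN; rewrite big_split /= mulrC; congr (_ * _).
  by rewrite prodrXr -big_distrr /= bN.
rewrite /Fn nth0 -/s -/n.
set P := \prod_(d <- c) gap_poly R d.+1; set u := P`_Nb; set G := g _.
(* The exponents agree because [Nh = Nb + k + 1]. *)
have e : s ^+ k * s * s ^+ (2 * Nb) = s ^+ Nh * s ^+ Nb.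
  by rewrite -exprSr -!exprD; congr (_ ^+ _); lia.
have -> : #|@any_start n Nb Nh|%:R = 'C(n, Nh)%:R * n%:R ^+ Nb :> R.
  by rewrite -natrX -natrM -card_any_start cardsE.
have -> : ('C(n, Nh)%:R * n%:R ^+ Nb)^-1 = 'C(n, Nh)%:R^-1 * s ^+ Nb :> R.
  by rewrite invfM /s /scale exprVn.
rewrite -[X in _ * X = _]mulr_natr exprMn invfM.
set d := (head _ _).+1%:R.
transitivity (N%:R ^- k * N%:R ^+ k * (('C(n, Nh)%:R)^-1 * Nb`!%:R * u * G * d) *
    ((s ^+ Nh)^-1 * (s ^+ k * s * s ^+ (2 * Nb)))); last by ring.
rewrite e mulVf ?expf_neq0 // mulKf ?expf_neq0 //.
ring.
Qed.

End DropExpectation.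

Theorem mainTheorem3 (R : realType) (Nb Nh : nat) (p : R) :
  (Nb < Nh)%N -> 0 <= p <= 1 ->
  forall g : 'rV[R]_(Nh - Nb) -> R,
    continuous g ->
    (exists M : R, forall v, `|g v| <= M) ->
    (fun n : nat => golf_expect n Nb Nh p g) @ \oo --> limit_expect Nb Nh g.
Proof.
move=> NbNh p01 g g_cont [M gM].
pose k := (Nh - Nb).-1.
have NhE : (Nh - Nb = k.+1)%N by rewrite /k; lia.
rewrite -(@cvg_shiftn k.+1).
have [K K0 HK] := grid_term_bound NhE gM.
have drop_cvg : (fun N => drop_expect p g (N + k.+1)) @ \oo --> limit_expect Nb Nh g.
  have := riemann_sum_cvg K0 HK (cell_fun_grid NhE g_cont).
  apply: cvg_trans; apply: near_eq_cvg; near=> N.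
  have N0 : (0 < N)%N by near: N; exact: nbhs_infty_gt.
  by rewrite (drop_expectE p01).
(* The difference is at most [2 M] times the probability that uniformly dropped balls meet each
   other or a hole, which tends to 0. *)
have -> : (fun N => golf_expect (N + k.+1) Nb Nh p g) = (fun N => drop_expect p g (N + k.+1) +
    (golf_expect (N + k.+1) Nb Nh p g - drop_expect p g (N + k.+1))).
  by apply/funext => N; rewrite addrCA subrr addr0.
rewrite -[limit_expect Nb Nh g]addr0; apply: cvgD => //.
apply/norm_cvg0P.
apply: (@squeeze_cvgr _ _ _ _ (fun=> 0) (fun N => 2 * M *
  (1 - (('C(N + k.+1, Nh) * (N + k.+1 - Nh) ^_ Nb)%N)%:R /
       (('C(N + k.+1, Nh) * (N + k.+1) ^ Nb)%N)%:R))).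
- near=> N; rewrite normr_ge0 /=; apply: (golf_drop_dist p01 gM).
  (* For such [N] all holes and balls fit on distinct sites, so a valid start exists. *)
  have NN : (Nh + Nb <= N)%N by near: N; exact: nbhs_infty_ge.
  rewrite -cardsE card_valid_start muln_gt0 bin_gt0 ffact_gt0; lia.
- exact: cvg_cst.
- have -> : (0 : R) = 2 * M * (1 - 1) by rewrite subrr mulr0.
  by apply: cvgMl_tmp; apply: cvgB; [exact: cvg_cst|exact: cvg_ffact_ratio].
Unshelve. all: by end_near. Qed.
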